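(* Let $n$ be an integer and let $A_n(L,M)$ be the A-polynomial of the twist knot $K_n = J(2,2n)$. When $n \geq 0$, \[ A_n (L,M) = M^{2n} (L+M^2)^{2n-1} \sum_{i=0}^{2n-1} \binom{n + \lfloor \frac{i-1}{2} \rfloor }{i} \left( \frac{ M^2 - 1 }{ L+M^2} \right)^i \left( 1 - L \right)^{ \lfloor \frac{i}{2} \rfloor } \left( M^2 - L M^{-2} \right)^{ \lfloor \frac{i+1}{2} \rfloor }. \] When $n \leq 0$, \[ A_n (L,M) = M^{-2n} (L+M^2)^{-2n} \sum_{i=0}^{-2n} \binom{-n + \lfloor \frac{i}{2} \rfloor}{i} \left( \frac{M^2 - 1}{L+M^2} \right)^i (1-L)^{\lfloor \frac{i}{2} \rfloor} (M^2 - LM^{-2})^{ \lfloor \frac{i+1}{2} \rfloor }. \]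
   Context: For integers $k,l$, $J(k,l)$ denotes the two-bridge knot or link formed by two twist regions containing $k$ and $l$ right-handed half twists respectively; the twist knot $K_n = J(2,2n)$ has $n$ full twists in the second region ($K_0$ is the unknot, $K_1$ is a trefoil, $K_{-1}$ is the figure-eight knot). Its knot group has the presentation \[ \pi_1(S^3 \setminus K_n) = \langle a, b \mid a w^n = w^n b \rangle, \qquad w = a b^{-1} a^{-1} b, \] where $a$ and $b$ are meridians, and a longitude commuting with $a$ is $\lambda = w^n \overline{w}^n$, where $\overline{w} = b a^{-1} b^{-1} a$ (this fixes the chirality and orientation conventions). A-polynomial: consider all irreducible representations $\rho : \pi_1(S^3\setminus K_n) \to SL_2(\mathbb{C})$ such that $\rho(a)$ and $\rho(\lambda)$ are both upper triangular, and let $M$ and $L$ be the upper-left entries of $\rho(a)$ and $\rho(\lambda)$ respectively. The A-polynomial $A_n(L,M) \in \mathbb{Z}[L,M]$ is the defining polynomial of the union of the one-dimensional components of the Zariski closure in $\mathbb{C}^2$ of the set of all such pairs $(L,M)$, taken without repeated factors, with coprime integer coefficients, and not divisible by $L$ or $M$; it is well defined up to sign. It is the constant $1$ if there are no such components, as for $n=0$. In this convention the factor $L-1$ coming from reducible (abelian) representations is not included. $\lfloor x\rfloor$ denotes the floor of $x$. The right-hand sides are elements of the field of rational functions in $L, M$.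
   Formalization: The first formula is asserted only for n > 0 (at n = 0 its sum is empty, giving 0, but A_0 = 1; n = 0 is covered by the second). In the second formula M^2-1 is replaced by 1-M^2: as printed it fails for the figure-eight knot, n = -1. *)

(* Defs.v *)
From HB Require Import structures.
From mathcomp Require Import all_boot all_order all_algebra.
From mathcomp Require Import boolp classical_sets reals.
From mathcomp Require Import complex.

Set Implicit Arguments.
Unset Strict Implicit.
Unset Printing Implicit Defensive.

Import GRing.Theory.

Section Presentation.
Variables (X : choiceType) (E : seq (X * bool) -> seq (X * bool) -> Prop).

(* [(x, true)] stands for the letter x and [(x, false)] for x^-1. *)
Local Notation word := (seq (X * bool)).

Inductive pres_eq : word -> word -> Prop :=
| pres_rel u v of E u v : pres_eq u v
| pres_cancel x e : pres_eq [:: (x, e); (x, ~~ e)] [::]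
| pres_cat u u' v v' of pres_eq u u' & pres_eq v v' :
    pres_eq (u ++ v) (u' ++ v')
| pres_refl u : pres_eq u u
| pres_sym u v of pres_eq u v : pres_eq v u
| pres_trans u v t of pres_eq u v & pres_eq v t : pres_eq u t.

Definition pres_eqb (u v : word) : bool := `[< pres_eq u v >].

Lemma pres_eqb_equiv : equiv_class_of pres_eqb.
Proof.
split=> [u|u v|v u t].
- exact/asboolP/pres_refl.
- by apply/asboolP/asboolP; apply: pres_sym.
- by move=> /asboolP uv /asboolP vt; apply/asboolP/(pres_trans uv vt).
Qed.

Canonical pres_equiv := EquivRelPack pres_eqb_equiv.

Definition presented : Type := {eq_quot pres_equiv}%qT.
HB.instance Definition _ := EqQuotient.on presented.
HB.instance Definition _ := Choice.on presented.

Definition pres_class (u : word) : presented := (\pi_presented u)%qT.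

Lemma pres_classP u v : pres_class u = pres_class v <-> pres_eq u v.
Proof. by split=> [/eqmodP/asboolP //|uv]; apply/eqmodP/asboolP. Qed.

Lemma pres_class_surj (g : presented) : exists u, g = pres_class u.
Proof. by exists (repr g); rewrite /pres_class reprK. Qed.

Definition winv (u : word) : word := rev [seq (p.1, ~~ p.2) | p <- u].

Lemma winv_cat u v : winv (u ++ v) = winv v ++ winv u.
Proof. by rewrite /winv map_cat rev_cat. Qed.

Lemma winvK : involutive winv.
Proof.
move=> u; rewrite /winv map_rev revK -map_comp map_id_in //.
by case=> x e _ /=; rewrite negbK.
Qed.

Lemma pres_winvr u : pres_eq (u ++ winv u) [::].
Proof.
elim: u => [|[x e] u IH]; first exact: pres_refl.
rewrite -cat1s winv_cat catA -(catA [:: _]).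
apply: pres_trans (pres_cancel x e).
apply: (@pres_cat _ [:: (x, e)] _ [:: (x, ~~ e)]); last exact: pres_refl.
by rewrite -[X in pres_eq _ X]cats0; apply: pres_cat IH; apply: pres_refl.
Qed.

Lemma pres_winvl u : pres_eq (winv u ++ u) [::].
Proof. by rewrite -{2}[u]winvK; apply: pres_winvr. Qed.

Lemma pres_winv u v : pres_eq u v -> pres_eq (winv u) (winv v).
Proof.
move=> uv.
have h1 : pres_eq (winv u) (winv u ++ (v ++ winv v)).
  rewrite -[X in pres_eq X _]cats0; apply: pres_cat; first exact: pres_refl.
  exact/pres_sym/pres_winvr.
apply: (pres_trans h1); rewrite catA -[X in pres_eq _ X]cat0s.
apply: pres_cat (pres_refl _).
apply: pres_trans (pres_winvl u).
by apply: pres_cat (pres_refl _) (pres_sym uv).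
Qed.

Definition pres_mul (g h : presented) : presented :=
  pres_class (repr g ++ repr h).
Definition pres_one : presented := pres_class [::].
Definition pres_inv (g : presented) : presented := pres_class (winv (repr g)).

Lemma pres_repr u : pres_eq (repr (pres_class u)) u.
Proof. by apply/pres_classP; rewrite /pres_class reprK. Qed.

Lemma pres_mulE u v :
  pres_mul (pres_class u) (pres_class v) = pres_class (u ++ v).
Proof. by apply/pres_classP/pres_cat; apply: pres_repr. Qed.

Lemma pres_invE u : pres_inv (pres_class u) = pres_class (winv u).
Proof. exact/pres_classP/pres_winv/pres_repr. Qed.

Lemma pres_mulA : associative pres_mul.
Proof.
move=> g h k; have [u ->] := pres_class_surj g.
have [v ->] := pres_class_surj h; have [t ->] := pres_class_surj k.
by rewrite !pres_mulE catA.
Qed.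

Lemma pres_mul1g : left_id pres_one pres_mul.
Proof. by move=> g; have [u ->] := pres_class_surj g; rewrite pres_mulE. Qed.

Lemma pres_mulg1 : right_id pres_one pres_mul.
Proof.
by move=> g; have [u ->] := pres_class_surj g; rewrite pres_mulE cats0.
Qed.

Lemma pres_mulVg : left_inverse pres_one pres_inv pres_mul.
Proof.
move=> g; have [u ->] := pres_class_surj g.
by rewrite pres_invE pres_mulE; apply/pres_classP/pres_winvl.
Qed.

Lemma pres_mulgV : right_inverse pres_one pres_inv pres_mul.
Proof.
move=> g; have [u ->] := pres_class_surj g.
by rewrite pres_invE pres_mulE; apply/pres_classP/pres_winvr.
Qed.

HB.instance Definition _ := isGroup.Build presented
  pres_mulA pres_mul1g pres_mulg1 pres_mulVg pres_mulgV.

Definition pres_gen (x : X) : presented := pres_class [:: (x, true)].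

Definition wexpz (u : word) (n : int) : word :=
  match n with
  | Posz m => flatten (nseq m u)
  | Negz m => flatten (nseq m.+1 (winv u))
  end.

End Presentation.

Definition expgz (G : groupType) (x : G) (n : int) : G :=
  match n with
  | Posz m => (x ^+ m)%g
  | Negz m => (x ^- m.+1)%g
  end.

Section TwistKnot.
Variable n : int.

(* The generators are indexed by bool: true for a and false for b. *)
Let a : seq (bool * bool) := [:: (true, true)].
Let b : seq (bool * bool) := [:: (false, true)].
Let w := a ++ winv b ++ winv a ++ b.

Inductive twist_rel : seq (bool * bool) -> seq (bool * bool) -> Prop :=
| TwistRel : twist_rel (a ++ wexpz w n) (wexpz w n ++ b).

Definition twist_group := presented twist_rel.

Definition meridian_a : twist_group := pres_gen twist_rel true.
Definition meridian_b : twist_group := pres_gen twist_rel false.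

Definition twist_w : twist_group :=
  (meridian_a * meridian_b^-1 * meridian_a^-1 * meridian_b)%g.
Definition twist_wbar : twist_group :=
  (meridian_b * meridian_a^-1 * meridian_b^-1 * meridian_a)%g.

Definition longitude : twist_group :=
  (expgz twist_w n * expgz twist_wbar n)%g.

Lemma twist_wE : twist_w = pres_class twist_rel w.
Proof.
have mE := pres_mulE twist_rel; have iE := pres_invE twist_rel.
rewrite /twist_w /meridian_a /meridian_b /pres_gen.
by rewrite -![(_^-1)%g]/(pres_inv _) -![(_ * _)%g]/(pres_mul _ _) !iE !mE.
Qed.

Lemma expgz_class u m :
  expgz (pres_class twist_rel u : twist_group) m
    = pres_class twist_rel (wexpz u m).
Proof.
have exp_class v k :
    ((pres_class twist_rel v : twist_group) ^+ k)%g
      = pres_class twist_rel (flatten (nseq k v)).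
  elim: k => [|k IH]; first by rewrite expg0.
  by rewrite expgS IH; apply: pres_mulE.
case: m => m; first exact: exp_class.
rewrite /expgz /wexpz -exp_class -expVgn; congr (_ ^+ _)%g.
exact: pres_invE.
Qed.

Lemma twist_group_rel :
  (meridian_a * expgz twist_w n = expgz twist_w n * meridian_b)%g.
Proof.
rewrite twist_wE expgz_class -![(_ * _)%g]/(pres_mul _ _) !pres_mulE.
exact/pres_classP/pres_rel/TwistRel.
Qed.

End TwistKnot.

Local Open Scope classical_set_scope.
Local Open Scope ring_scope.

Section Representations.
Variables (R : realType) (G : groupType).

Definition SL2_rep (rho : G -> 'M[R[i]]_2) : Prop :=
  (forall g h, rho (g * h)%g = rho g *m rho h) /\
  (forall g, \det (rho g) = 1).

Definition irreducible_rep (rho : G -> 'M[R[i]]_2) : Prop :=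
  forall U : {vspace 'cV[R[i]]_2},
    (forall g v, v \in U -> rho g *m v \in U) ->
    U = 0%VS \/ U = fullv.

End Representations.

Definition upper_triangular (K : nzRingType) (A : 'M[K]_2) : Prop :=
  forall i j : 'I_2, (j < i)%N -> A i j = 0.

(* Points of C^2 are written (L, M). *)
Definition eigenvalue_pairs (R : realType) (n : int) : set (R[i] * R[i]) :=
  [set LM | exists rho : twist_group n -> 'M[R[i]]_2,
    [/\ SL2_rep rho, irreducible_rep rho,
        upper_triangular (rho (meridian_a n)),
        upper_triangular (rho (longitude n)) &
        LM = (rho (longitude n) 0 0, rho (meridian_a n) 0 0)]].

(* An element of {poly {poly K}} is a polynomial in L and M: the outer
   indeterminate 'X is L and the inner one 'X%:P is M. *)
Definition eval2 (K : comNzRingType) (f : {poly {poly K}}) (x : K * K) : K :=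
  f.[x.1%:P].[x.2].

Section Zariski.
Variable K : fieldType.
Implicit Types (S X Y Z : set (K * K)) (F : set {poly {poly K}}).

Definition zero_locus F : set (K * K) :=
  [set x | forall f, F f -> eval2 f x = 0].

Definition vanishing_ideal S : set {poly {poly K}} :=
  [set f | forall x, S x -> eval2 f x = 0].

Definition zariski_closed X : Prop := exists F, X = zero_locus F.

Definition zariski_closure S : set (K * K) := zero_locus (vanishing_ideal S).

Definition irreducible_closed X : Prop :=
  [/\ zariski_closed X, X !=set0 &
      forall Y Z, zariski_closed Y -> zariski_closed Z ->
        X `<=` Y `|` Z -> X `<=` Y \/ X `<=` Z].

Definition irreducible_component X Z : Prop :=
  [/\ irreducible_closed Z, Z `<=` X &
      forall Y, irreducible_closed Y -> Y `<=` X -> Z `<=` Y -> Y = Z].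

(* A chain Y_0 < Y_1 < ... < Y_d of irreducible closed subsets of X. *)
Definition irreducible_chain X (d : nat) : Prop :=
  exists Y : nat -> set (K * K),
    (forall i, (i <= d)%N -> irreducible_closed (Y i) /\ Y i `<=` X) /\
    (forall i, (i < d)%N -> Y i `<` Y i.+1).

Definition krull_dim X (d : nat) : Prop :=
  irreducible_chain X d /\ ~ irreducible_chain X d.+1.

Definition one_dim_part X : set (K * K) :=
  [set x | exists Z, [/\ irreducible_component X Z, krull_dim Z 1 & Z x]].

End Zariski.

Definition polyL : {poly {poly int}} := 'X.
Definition polyM : {poly {poly int}} := 'X%:P.

Definition divides2 (P Q : {poly {poly int}}) : Prop := exists T, Q = P * T.

Definition zero_set (R : realType) (A : {poly {poly int}}) :
    set (R[i] * R[i]) :=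
  [set x | eval2 (map_poly (map_poly (intr : int -> R[i])) A) x = 0].

(* The two signs +-A both qualify.  Nonzeroness of A is implied by the
   coprimality of the coefficients. *)
Definition A_polynomial (R : realType) (n : int) (A : {poly {poly int}}) :
    Prop :=
  [/\ zero_set A = one_dim_part (zariski_closure (@eigenvalue_pairs R n)),
      forall Q, divides2 (Q ^+ 2) A -> Q \is a GRing.unit,
      forall d : int, (forall i j, (d %| A`_i`_j)%Z) -> `|d| = 1,
      ~ divides2 polyL A & ~ divides2 polyM A].

Definition ratL : {fraction {poly {poly int}}} := tofrac polyL.
Definition ratM : {fraction {poly {poly int}}} := tofrac polyM.

(* Binomials and sums are over natural numbers: in the ranges where the
   formulas are used, the integers under absz are nonnegative, and the integer
   division (_ %/ 2)%Z is the floor of the half.  A_formula_pos is meant for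
   0 < n (its sum is empty at n = 0) and A_formula_neg for n <= 0.  In the
   latter the base of the i-th power is (1 - M^2) / (L + M^2); this sign gives
   L^2 M^4 + L (-1 + M^2 + 2 M^4 + M^6 - M^8) + M^4 for the figure-eight knot
   n = -1. *)
Definition A_formula_pos (n : int) : {fraction {poly {poly int}}} :=
  ratM ^ (2 * n) * (ratL + ratM ^+ 2) ^ (2 * n - 1) *
  \sum_(0 <= i < absz (2 * n))
    'C(absz (n + ((i%:Z - 1) %/ 2)%Z), i)%:R *
    ((ratM ^+ 2 - 1) / (ratL + ratM ^+ 2)) ^+ i *
    (1 - ratL) ^+ (i %/ 2) *
    (ratM ^+ 2 - ratL * ratM ^- 2) ^+ (i.+1 %/ 2).

Definition A_formula_neg (n : int) : {fraction {poly {poly int}}} :=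
  ratM ^ (- 2 * n) * (ratL + ratM ^+ 2) ^ (- 2 * n) *
  \sum_(0 <= i < (absz (- 2 * n)).+1)
    'C(absz (- n + (i%:Z %/ 2)%Z), i)%:R *
    ((1 - ratM ^+ 2) / (ratL + ratM ^+ 2)) ^+ i *
    (1 - ratL) ^+ (i %/ 2) *
    (ratM ^+ 2 - ratL * ratM ^- 2) ^+ (i.+1 %/ 2).

(* Main.v *)
(* Every irreducible representation with rho(a) upper triangular is conjugate,
   by an upper triangular matrix, to a = [[M, v], [0, 1/M]] and
   b = [[M, 0], [s, 1/M]] with s <> 0.  Put r = s v, u = (M - 1/M)^2.  Then
   tr w = x = 2 + r (r + u) and a w - w b = g (a - b) with g = 1 + r + u, so by
   Cayley-Hamilton a w^n - w^n b = phi_n (a - b), where phi_n satisfies the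
   recurrence phi_{n+1} = x phi_n - phi_{n-1}, phi_0 = 1, phi_1 = g.  The relation
   thus reads phi_n = 0, and it forces w^n to be a multiple of w - g, hence
   lambda = (w - g) (wbar - g) / det (w - g), independently of n.  This gives
   (M^2 - 1) (1 - L) = r (L + M^2), and eliminating r from phi_n = 0 yields a
   polynomial F in L and M; expanding phi_n in binomial coefficients gives the
   stated formula.

   That F is the A-polynomial rests on two facts: its leading coefficient in L is
   a power of M, and for infinitely many M it has deg_L F distinct roots L coming
   from representations (at u = -4 the roots r of phi_n are 2 - t - 1/t with t a
   root of unity of odd order, so the discriminant of phi_n in r is not zero).
   Pseudo-division then shows that every polynomial vanishing on the eigenvalue
   pairs is a multiple of F; squarefreeness, the Zariski closure and uniqueness
   all follow from this and from unique factorization in D[M][L]. *)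
Require Import Defs.
From mathcomp Require Import all_boot all_order all_algebra.
From mathcomp Require Import separable cyclotomic.
From mathcomp Require Import boolp classical_sets reals complex.
From mathcomp Require Import ring zify.

Set Implicit Arguments.
Unset Strict Implicit.
Unset Printing Implicit Defensive.

Import Order.TTheory GRing.Theory Num.Theory.
Local Open Scope ring_scope.

(** * Unique factorization *)

Section Divisibility.
Variable D : idomainType.
Implicit Types a b c p q u : D.

Definition dvdr a b : Prop := exists c, b = a * c.

Definition prime_elt p : Prop :=
  [/\ p != 0, p \isn't a GRing.unit &
      forall a b, dvdr p (a * b) -> dvdr p a \/ dvdr p b].

(** Asking for prime rather than irreducible factors builds uniqueness of the factorization into its
    existence. *)
Definition factorial_ring : Prop :=
  forall a, a != 0 -> exists s : seq D, exists2 u, u \is a GRing.unit &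
    (forall p, p \in s -> prime_elt p) /\ a = u * \prod_(p <- s) p.

Lemma dvdrr a : dvdr a a.
Proof. by exists 1; rewrite mulr1. Qed.

Lemma dvdr_mulr a b c : dvdr a b -> dvdr a (b * c).
Proof. by case=> d ->; exists (d * c); rewrite mulrA. Qed.

Lemma dvdr_mull a b c : dvdr a b -> dvdr a (c * b).
Proof. by rewrite mulrC; apply: dvdr_mulr. Qed.

Lemma dvdrD a b c : dvdr a b -> dvdr a c -> dvdr a (b + c).
Proof. by case=> d -> [e ->]; exists (d + e); rewrite mulrDr. Qed.

Lemma dvdrB a b c : dvdr a b -> dvdr a c -> dvdr a (b - c).
Proof. by case=> d -> [e ->]; exists (d - e); rewrite mulrBr. Qed.

Lemma prime_elt_assoc p q : prime_elt p -> prime_elt q -> dvdr p q -> dvdr q p.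
Proof.
move=> [p0 pu pP] [q0 qu qP] [e qE].
have: dvdr q (p * e) by rewrite -qE; apply: dvdrr.
case/qP=> // -[k eE]; case/negP: pu; apply/unitrPr; exists k.
by apply: (mulfI q0); rewrite mulr1 {2}qE eE; rewrite mulrCA mulrA.
Qed.

Lemma prime_elt_dvd_prod p u (s : seq D) :
  prime_elt p -> u \is a GRing.unit -> dvdr p (u * \prod_(q <- s) q) ->
  exists2 q, q \in s & dvdr p q.
Proof.
move=> pp uu; elim: s => [|q s IH].
  rewrite big_nil mulr1 => -[c uE]; case: pp => _ /negP pu _; case: pu.
  by move: uu; rewrite uE unitrM => /andP[].
rewrite big_cons mulrCA; case: (pp) => _ _ pP /pP[pq|/IH[t ts pt]].
  by exists q; rewrite ?mem_head.
by exists t; rewrite // inE ts orbT.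
Qed.

(** The drop in the number of prime factors is the induction measure in
    [extract_prime_constants]. *)
Lemma factorization_cancel p a u (s : seq D) :
  prime_elt p -> (forall q, q \in s -> prime_elt q) ->
  u \is a GRing.unit -> p * a = u * \prod_(q <- s) q ->
  exists s' : seq D, exists2 u', u' \is a GRing.unit &
   [/\ forall q, q \in s' -> prime_elt q, size s = (size s').+1 &
       a = u' * \prod_(q <- s') q].
Proof.
move=> pp sP uu E.
have [q qs pq] : exists2 q, q \in s & dvdr p q.
  by apply: (prime_elt_dvd_prod pp uu); rewrite -E; exists a.
have [c pE] := prime_elt_assoc pp (sP _ qs) pq; have [e qE] := pq.
have p0 : p != 0 by case: pp.
have eu : e \is a GRing.unit.
  apply/unitrPr; exists c; apply: (mulfI p0).
  by rewrite mulr1 mulrA -qE -pE.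
exists (rem q s), (u * e); first by rewrite unitrM uu.
split=> [t /mem_rem/sP //||]; first by rewrite size_rem // prednK //;
  case: s qs {sP E}.
apply: (mulfI p0); rewrite E (big_rem q) //= {1}qE.
by rewrite !mulrA [p * u]mulrC.
Qed.

End Divisibility.

(** * Gauss's lemma and polynomials over a factorial ring *)

Section FactorialPoly.
Variable D : idomainType.
Implicit Types (c p : D) (f g h : {poly D}).

Lemma dvdr_polyC p f : dvdr p%:P f <-> forall i, dvdr p f`_i.
Proof.
split=> [[g ->] i|]; first by exists g`_i; rewrite coefCM.
elim/poly_ind: f => [|f c IH] fP; first by exists 0; rewrite mulr0.
apply: dvdrD; last first.
  by have := fP 0; rewrite coefD coefMX coefC /= add0r => -[e ->]; exists e%:P;
    rewrite rmorphM.
apply/dvdr_mulr/IH => i; have := fP i.+1.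
by rewrite coefD coefMX coefC /= addr0.
Qed.

Lemma prime_polyC p : prime_elt p -> prime_elt p%:P.
Proof.
case=> p0 pu pP; split; first by rewrite polyC_eq0.
  by rewrite poly_unitE coefC eqxx (negbTE pu) andbF.
have dvdX f : dvdr p%:P (f * 'X) -> dvdr p%:P f.
  by move=> /dvdr_polyC fP; apply/dvdr_polyC => i; have := fP i.+1;
    rewrite coefMX.
have dvdC c : dvdr p c -> dvdr p%:P c%:P.
  by case=> e ->; exists e%:P; rewrite rmorphM.
elim/poly_ind => [|f a IHf]; first by left; exists 0; rewrite mulr0.
have [pa|npa] := pselect (dvdr p a).
  move=> g; rewrite mulrDl => fg.
  have: dvdr p%:P (f * g * 'X).
    rewrite -(addrK (a%:P * g) (f * g * 'X)); apply: dvdrB; first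
      by rewrite mulrAC.
    exact/dvdr_mulr/dvdC.
  by move=> /dvdX/IHf[]; [left; apply/dvdrD/dvdC => //; apply: dvdr_mulr|right].
elim/poly_ind => [|g b IHg]; first by right; exists 0; rewrite mulr0.
move=> fg; have pb : dvdr p b.
  have := (dvdr_polyC p _).1 fg 0.
  by rewrite coef0M !coefD !coefMX !coefC /= !add0r => /pP[].
have: dvdr p%:P ((f * 'X + a%:P) * g * 'X).
  rewrite -[_ * 'X](addrK ((f * 'X + a%:P) * b%:P)); apply: dvdrB.
    by rewrite -mulrA -mulrDr.
  exact/dvdr_mull/dvdC.
move=> /dvdX/IHg[]; first by left.
by move=> pg; right; apply/dvdrD/dvdC => //; apply: dvdr_mulr.
Qed.

Lemma size_polyC_mul c f : c != 0 -> size (c%:P * f) = size f.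
Proof. by move=> c0; rewrite mul_polyC size_scale. Qed.

(** For nonzero f over a factorial ring this says that f is primitive. *)
Definition no_prime_constant f : Prop :=
  forall p, prime_elt p -> ~ dvdr p%:P f.

Lemma dvdr_cancel_primes (s : seq D) f g :
  (forall p, p \in s -> prime_elt p /\ ~ dvdr p%:P f) ->
  dvdr f ((\prod_(p <- s) p)%:P * g) -> dvdr f g.
Proof.
elim: s g => [|p s IH] g sP; first by rewrite big_nil mul1r.
rewrite big_cons rmorphM /= -mulrA => -[h E].
have [pp npf] := sP p (mem_head _ _).
have [p0 _ pP] := prime_polyC pp.
have: dvdr p%:P (f * h) by rewrite -E; exists ((\prod_(j <- s) j)%:P * g).
move=> /pP[//|[k hE]]; apply: IH => [q qs|]; first by apply: sP;
  rewrite inE qs orbT.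
by exists k; apply: (mulfI p0); rewrite E hE mulrCA.
Qed.

Lemma dvdr_cancel_const c f g : factorial_ring D -> no_prime_constant f ->
  c != 0 -> dvdr f (c%:P * g) -> dvdr f g.
Proof.
move=> DF fP /DF[s [u uu [sP ->]]] fg.
apply: (@dvdr_cancel_primes s) => [p ps|].
  by split; [apply: sP|apply/fP/sP].
case: fg => h E; exists ((u^-1)%:P * h).
by rewrite mulrCA -E mulrA -polyCM mulrA mulVr // mul1r.
Qed.

(** A factorization over the fraction field descends to D[X]: each prime factor of c divides g or h
    and is cancelled there, which leaves the degrees unchanged. *)
Lemma split_cancel_const c f g h : factorial_ring D -> c != 0 ->
  c%:P * f = g * h ->
  exists g' h', [/\ f = g' * h', size g' = size g & size h' = size h].
Proof.
move=> DF /DF[s [u uu [sP ->]]]; rewrite polyCM mulrAC => E.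
have u0 : u != 0 by apply: contraTneq uu => ->; rewrite unitr0.
have Vu0 : u^-1 != 0 by rewrite invr_eq0.
suff [g' [h' [E' sg sh]]] :
    exists g' h', [/\ u%:P * f = g' * h', size g' = size g & size h' = size h].
  exists ((u^-1)%:P * g'), h'; split=> //.
    by rewrite -mulrA -E' mulrA -polyCM mulVr // mul1r.
  by rewrite size_polyC_mul.
move: (u%:P * f) E => {}f; rewrite [LHS]mulrC.
elim: s g h sP => [|p s IH] g h sP; first by rewrite big_nil mul1r => ->;
  exists g, h.
have pp := sP p (mem_head _ _).
have {}sP q : q \in s -> prime_elt q by move=> qs; apply: sP;
  rewrite inE qs orbT.
have p0 : p != 0 by case: pp.
have [pP0 _ pP] := prime_polyC pp.
rewrite big_cons rmorphM /= -mulrA => E.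
have: dvdr p%:P (g * h) by rewrite -E; eexists; reflexivity.
move=> /pP[] [k kE]; rewrite kE in E *.
  have [|g' [h' [fE gk hh]]] := IH k h sP; first by apply: (mulfI pP0);
    rewrite E mulrA.
  by exists g', h'; rewrite size_polyC_mul.
have [|g' [h' [fE gg hk]]] := IH g k sP; first by apply: (mulfI pP0);
  rewrite E mulrCA.
by exists g', h'; rewrite size_polyC_mul.
Qed.

(** The process stops because each constant prime taken out of f removes a prime factor from its
    leading coefficient. *)
Lemma extract_prime_constants f : factorial_ring D -> f != 0 ->
  exists (s : seq D) f', [/\ forall p, p \in s -> prime_elt p,
    f = (\prod_(p <- s) p)%:P * f' & no_prime_constant f'].
Proof.
move=> DF f0; have lf0 : lead_coef f != 0 by rewrite lead_coef_eq0.
have [s [u uu [sP]]] := DF _ lf0.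
move sn: (size s) => k;
  elim: k s u f uu sP sn f0 {lf0} => [|k IH] s u f uu sP sn f0 lf.
all: have [fP|] := pselect (no_prime_constant f);
  first by exists [::], f; rewrite big_nil mul1r.
all: move=> /existsNP[p /not_implyP[pp /contrapT[g fE]]].
all: have E : p * lead_coef g = u * \prod_(q <- s) q
  by rewrite -lf fE lead_coefM lead_coefC.
all: have [s' [u' uu' [s'P ss' lg]]] := factorization_cancel pp sP uu E.
  by rewrite sn in ss'.
have g0 : g != 0 by apply: contraNneq f0 => g0; rewrite fE g0 mulr0.
have [|t [f' [tP gE f'P]]] := IH s' u' g uu' s'P _ g0 lg; first by move: ss';
  rewrite sn => -[].
exists (p :: t), f'; split=> //; last by rewrite fE gE big_cons polyCM mulrA.
by move=> q; rewrite inE => /orP[/eqP->|/tP].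
Qed.

Lemma coprimep_bezout f g : coprimep f g ->
  exists c v w, c != 0 /\ v * f + w * g = c%:P.
Proof.
move=> /Bezout_coprimepP[[v w] /=];
  rewrite -size_poly_eq1 => /size_poly1P[c c0 E].
by exists c, v, w.
Qed.

(** Suppose f divides g * h and take the gcd of f and g over the fraction field. If it is constant,
    a Bezout identity shows that f divides a constant multiple of h; otherwise indecomposability
    makes it an associate of f, and f divides a constant multiple of g. Primitivity of f removes the
    constants. *)
Lemma prime_poly_indecomposable f : factorial_ring D -> (1 < size f)%N ->
  no_prime_constant f ->
  (forall g h, f = g * h -> (size g <= 1)%N \/ (size h <= 1)%N) ->
  prime_elt f.
Proof.
move=> DF sf fP find; have f0 : f != 0 by rewrite -size_poly_gt0; case: size sf.
split=> //; first by rewrite poly_unitE negb_and (gtn_eqF sf).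
move=> g h [k ghE]; have [cop|ncop] := boolP (coprimep f g).
  right; have [c [v [w [c0 E]]]] := coprimep_bezout cop.
  apply: (dvdr_cancel_const DF fP c0); rewrite -E mulrDl; apply: dvdrD.
    exact/dvdr_mulr/dvdr_mull/dvdrr.
  by rewrite -mulrA ghE; exists (w * k); rewrite mulrCA.
left; set d := gcdp f g.
have sd : (1 < size d)%N.
  rewrite ltn_neqAle eq_sym size_poly_gt0 gcdp_eq0 (negPf f0) /= andbT.
  by rewrite -coprimep_def.
have [[c e] /= c0 E] := Pdiv.Idomain.dvdpP _ _ (dvdp_gcdl f g).
have e0 : e != 0.
  by apply: contraNneq f0 => e0;
    rewrite -size_poly_eq0 -(size_scale f c0) E e0 mul0r size_poly0.
(* From c f = e d one gets a factorization of f itself with the same degrees, and d has positive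
   degree. *)
have se : (size e <= 1)%N.
  rewrite -mul_polyC in E.
  have [e' [d' [E' se' sd']]] := split_cancel_const DF c0 E.
  have [] := find _ _ E'; first by rewrite se'.
  by rewrite sd' leqNgt -/d sd.
have df : d %= f.
  rewrite -dvdp_size_eqp ?dvdp_gcdl // -(size_scale f c0) E size_mul //; last
    first.
    by rewrite -size_poly_gt0; case: size sd.
  by move: (e0) se; rewrite -size_poly_gt0; case: (size e) => [|[|]].
have /Pdiv.Idomain.dvdpP[[a t] /= a0 gE] : f %| g
  by rewrite -(eqp_dvdl _ df) dvdp_gcdr.
by apply: (dvdr_cancel_const DF fP a0); exists t; rewrite mul_polyC gE mulrC.
Qed.

(** Induction on the degree. A polynomial that is not a product of two factors of smaller degree is
    either a constant, factored in D, or prime once its constant prime factors are taken out. *)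
Theorem factorial_poly : factorial_ring D -> factorial_ring {poly D}.
Proof.
move=> DF f; have [n] := ubnP (size f); elim: n f => // n IH f sf f0.
have [[g [h [fE sg sh]]]|find] := pselect (exists g h,
    [/\ f = g * h, (size g < size f)%N & (size h < size f)%N]).
  have /norP[g0 h0] : ~~ ((g == 0) || (h == 0)) by rewrite -mulf_eq0 -fE.
  have [s [u uu [sP gE]]] := IH g (leq_trans sg sf) g0.
  have [t [v vu [tP hE]]] := IH h (leq_trans sh sf) h0.
  exists (s ++ t), (u * v); first by rewrite unitrM uu.
  split; first by move=> p; rewrite mem_cat => /orP[/sP|/tP].
  by rewrite fE gE hE big_cat mulrACA.
have [s1|s1] := leqP (size f) 1.
  have fE := size1_polyC s1; rewrite fE polyC_eq0 in f0.
  have [s [u uu [sP E]]] := DF _ f0.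
  exists (map polyC s), u%:P; first by rewrite rmorph_unit.
  split; first by move=> _ /mapP[p /sP/prime_polyC ? ->].
  by rewrite big_map fE E polyCM rmorph_prod.
have [s [f' [sP fE f'P]]] := extract_prime_constants DF f0.
have c0 : \prod_(p <- s) p != 0.
  by apply: contraNneq f0 => c0; rewrite fE c0 mul0r.
have sf' : size f' = size f by rewrite fE size_polyC_mul.
exists (f' :: map polyC s), 1; rewrite ?unitr1 // mul1r; split; last first.
  by rewrite big_cons big_map {1}fE rmorph_prod mulrC.
move=> q; rewrite inE => /orP[/eqP->|/mapP[p /sP/prime_polyC ? ->//]].
apply: prime_poly_indecomposable => //; first by rewrite sf'.
move=> g h f'E; apply: contrapT => /not_orP[/negP sg /negP sh]; apply: find.
rewrite -!ltnNge in sg sh.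
have g0 : g != 0 by rewrite -size_poly_gt0; case: size sg.
have h0 : h != 0 by rewrite -size_poly_gt0; case: size sh.
exists ((\prod_(p <- s) p)%:P * g), h; split; first by rewrite fE f'E mulrA.
  rewrite size_polyC_mul // -sf' f'E size_mul //;
    case: (size h) sh => [|[|k]] // _.
  by rewrite !addnS /= ltnS leq_addr.
rewrite -sf' f'E size_mul //; case: (size g) sg => [|[|k]] // _.
by rewrite !addSn /= ltnS leq_addl.
Qed.

(** Suppose the gcd d of f and g is not constant. From c f = e d, primality gives f | e, which makes
    d constant, or f | d, which makes f divide a constant multiple of g and hence g. *)
Lemma prime_poly_bezout f g : prime_elt f -> (1 < size f)%N -> ~ dvdr f g ->
  exists c v w, c != 0 /\ v * f + w * g = c%:P.
Proof.
move=> [f0 _ fP] sf nfg;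
  have [/coprimep_bezout //|ncop] := boolP (coprimep f g).
case: nfg; set d := gcdp f g.
have ndvdC c : c != 0 -> ~ dvdr f c%:P.
  move=> c0 [k E]; have k0 : k != 0.
    by apply: contraNneq c0 => k0; rewrite -polyC_eq0 E k0 mulr0.
  have := congr1 (fun p : {poly D} => size p) E;
    rewrite /= size_polyC c0 size_mul //.
  by move: k0; rewrite -size_poly_gt0; case: (size f) sf => [|[|?]] //;
    case: (size k) => // j; rewrite !addSn addnS.
have [[c e] /= c0 E] := Pdiv.Idomain.dvdpP _ _ (dvdp_gcdl f g);
  rewrite -/d in E.
have: dvdr f (e * d) by rewrite -E -mul_polyC; apply/dvdr_mull/dvdrr.
move=> /fP[[k eE]|fd].
  have: f * c%:P = f * (k * d) by rewrite mulrC mul_polyC E eE mulrA.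
  move=> /(mulfI f0) kd; have cP0 : c%:P != 0 by rewrite polyC_eq0.
  have dc : d %| c%:P by rewrite kd dvdp_mulIr.
  have := dvdp_leq cP0 dc; rewrite size_polyC c0 => sd; case/negP: ncop.
  by rewrite coprimep_def eqn_leq sd size_poly_gt0 gcdp_eq0 (negPf f0).
have [[a t] /= a0 gE] := Pdiv.Idomain.dvdpP _ _ (dvdp_gcdr f g);
  rewrite -/d in gE.
have: dvdr f (a%:P * g) by rewrite mul_polyC gE; apply: dvdr_mull.
by case/fP => // /(ndvdC _ a0).
Qed.
End FactorialPoly.

Lemma factorial_field (K : fieldType) : factorial_ring K.
Proof.
move=> a a0; exists [::], a; rewrite ?unitfE // big_nil mulr1; split=> //.
Qed.

Lemma unit_intE (a : int) : (a \is a GRing.unit) = (`|a|%N == 1%N).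
Proof. by case: a => [[|[|n]]|[|n]]. Qed.

Lemma dvdr_intE (p a : int) : dvdr p a <-> (p %| a)%Z.
Proof.
by split=> [[c ->]|/dvdzP[c ->]]; [apply: dvdz_mulr|exists c; rewrite mulrC].
Qed.

Lemma prime_elt_int (p : nat) : prime p -> prime_elt p%:Z.
Proof.
move=> pp; split; first by rewrite eqz_nat -lt0n prime_gt0.
  by rewrite unit_intE /= neq_ltn prime_gt1 ?orbT.
move=> a b /dvdr_intE; rewrite dvdzE abszM Euclid_dvdM // => /orP[?|?].
  by left; apply/dvdr_intE.
by right; apply/dvdr_intE.
Qed.

Lemma factorial_int : factorial_ring int.
Proof.
move=> a; have [n] := ubnP `|a|%N; elim: n a => // n IH a an a0.
have [a1|] := leqP `|a|%N 1.
  exists [::], a; last by rewrite big_nil mulr1.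
  by rewrite unit_intE; move: a0 a1; rewrite -absz_gt0; case: `|a|%N => [|[]].
move=> a1; have pp := pdiv_prime a1; set p := pdiv _ in pp.
have /dvdr_intE[b aE] : (p%:Z %| a)%Z by rewrite dvdzE pdiv_dvd.
have b0 : b != 0 by apply: contraNneq a0 => b0; rewrite aE b0 mulr0.
have [|s [u uu [sP bE]]] := IH b _ b0.
  rewrite -ltnS; apply: leq_trans an;
    rewrite ltnS aE abszM ltn_Pmull ?absz_gt0 //.
  exact: prime_gt1.
exists (p%:Z :: s), u => //; split; last by rewrite aE bE big_cons mulrCA.
by move=> q; rewrite inE => /orP[/eqP->|/sP //]; apply: prime_elt_int.
Qed.

(** * Vanishing of polynomials in two variables *)

Section Fibers.
Variable K : fieldType.
Implicit Types (f g : {poly {poly K}}) (l m : K).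

Definition fiber m f : {poly K} := map_poly (horner_eval m) f.

Lemma eval2_fiber f l m : eval2 f (l, m) = (fiber m f).[l].
Proof.
transitivity (fiber m f).[horner_eval m l%:P]; first
  by rewrite /fiber horner_map.
by rewrite /horner_eval hornerC.
Qed.

Lemma eval2M f g x : eval2 (f * g) x = eval2 f x * eval2 g x.
Proof. by case: x => l m; rewrite !eval2_fiber /fiber rmorphM hornerM. Qed.

Lemma eval2D f g x : eval2 (f + g) x = eval2 f x + eval2 g x.
Proof. by case: x => l m; rewrite !eval2_fiber /fiber rmorphD hornerD. Qed.

Lemma eval2C (c : {poly K}) x : eval2 c%:P x = c.[x.2].
Proof. by rewrite /eval2 hornerC. Qed.

Lemma eval2X x : eval2 ('X : {poly {poly K}}) x = x.1.
Proof. by rewrite /eval2 hornerX hornerC. Qed.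

Lemma eval2_outer_sub l x : eval2 ('X - l%:P%:P) x = x.1 - l.
Proof. by rewrite -polyCN eval2D eval2X eval2C hornerN hornerC. Qed.

Lemma eval2_inner_sub m x : eval2 ('X - m%:P)%:P x = x.2 - m.
Proof. by rewrite eval2C hornerXsubC. Qed.

Lemma eval2_dvdr f g x : dvdr f g -> eval2 f x = 0 -> eval2 g x = 0.
Proof. by case=> h ->; rewrite eval2M => ->; rewrite mul0r. Qed.

Lemma size_fiber f m : (lead_coef f).[m] != 0 -> size (fiber m f) = size f.
Proof. exact: size_map_poly_id0. Qed.

Lemma fiber_neq0 f m : (lead_coef f).[m] != 0 -> fiber m f != 0.
Proof.
by rewrite -size_poly_eq0 => lf; rewrite size_fiber // size_poly_eq0;
  apply: contraNneq lf => ->; rewrite lead_coef0 horner0.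
Qed.

End Fibers.

Lemma prime_XsubC (D : idomainType) (a : D) : prime_elt ('X - a%:P).
Proof.
have dvdE f : dvdr ('X - a%:P) f <-> root f a.
  split=> [[c ->]|/factor_theorem[q ->]]; first
    by rewrite rootM root_XsubC eqxx.
  by exists q; rewrite mulrC.
split; [by rewrite polyXsubC_eq0|by rewrite poly_unitE size_XsubC|].
by move=> f g /dvdE; rewrite rootM => /orP[]/dvdE; [left|right].
Qed.

Lemma closed_field_root (K : closedFieldType) (p : {poly K}) :
  (1 < size p)%N -> exists x, root p x.
Proof. by move=> sp; apply/closed_rootP; rewrite gtn_eqF. Qed.

Section Vanishing.
Variables (K : closedFieldType) (D : idomainType) (iota : {rmorphism D -> K}).
Hypothesis iota_inj : injective iota.
Implicit Types (f F P : {poly {poly D}}).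

(** D is instantiated by the integers for divisibility in Z[M][L], and by K itself for statements
    about Zariski closed sets. *)
Let ext f : {poly {poly K}} := map_poly (map_poly iota) f.

Let map_iota_inj : injective (map_poly iota).
Proof. exact: map_inj_poly iota_inj (rmorph0 _). Qed.

Let map_neq0 (c : {poly D}) : c != 0 -> map_poly iota c != 0.
Proof. by rewrite -(inj_eq map_iota_inj) rmorph0. Qed.

Lemma size_ext f : size (ext f) = size f.
Proof. by apply: size_map_inj_poly; rewrite ?rmorph0. Qed.

Lemma lead_coef_ext f : lead_coef (ext f) = map_poly iota (lead_coef f).
Proof. by apply: lead_coef_map_inj; rewrite ?rmorph0. Qed.

(* Nullstellensatz for a prime of positive degree in the outer variable. *)
Lemma prime_dvd_of_vanishing P f : prime_elt P -> (1 < size P)%N ->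
  (forall x, eval2 (ext P) x = 0 -> eval2 (ext f) x = 0) -> dvdr P f.
Proof.
move=> pP sP Pf; apply: contrapT => nPf.
have [c [v [w [c0 E]]]] := prime_poly_bezout pP sP nPf.
have lP0 : lead_coef P != 0 by rewrite lead_coef_eq0; case: pP.
have /closed_nonrootP[m] : map_poly iota (c * lead_coef P) != 0.
  by rewrite map_neq0 // mulf_neq0.
rewrite rmorphM rootM negb_or => /andP[cm lm].
have sPm : size (fiber m (ext P)) = size P.
  by rewrite size_fiber ?size_ext // lead_coef_ext.
have [|l /eqP] := @closed_field_root K (fiber m (ext P)); first by rewrite sPm.
rewrite -eval2_fiber => Pl.
case/negP: cm; rewrite /root -[_.[m]](eval2C _ (l, m)) -map_polyC -E /=.
by rewrite -/(ext _) /ext rmorphD !rmorphM /= eval2D !eval2M -!/(ext _) Pl (Pf _ Pl) !mulr0 addr0.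
Qed.

Variables (F : {poly {poly D}}) (k : nat) (E : set (K * K)).
Hypothesis lead_F : lead_coef F = 'X^k.
Hypothesis F_fiber0 : map_poly (horner_eval 0) F != 0.
Hypothesis E_dense : forall g : {poly K}, g != 0 -> exists m (ls : seq K),
  [/\ g.[m] != 0, uniq ls, size ls = (size F).-1 &
      forall l, l \in ls -> E (l, m)].
Hypothesis E_F : forall x, E x -> eval2 (ext F) x = 0.

(** The pseudo-remainder of f by F vanishes on E too. On a fiber where its leading coefficient
    survives it would have deg F distinct roots, more than its degree allows, so it is zero. *)
Lemma dvdr_of_vanishing f :
  (forall x, E x -> eval2 (ext f) x = 0) -> dvdr F f.
Proof.
move=> Ef; have F0 : F != 0 by apply: contraNneq F_fiber0 => ->;
  rewrite map_poly0.
have := Pdiv.Idomain.divp_eq f F; set R := f %% F; set Q := f %/ F;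
  set e := scalp _ _.
rewrite lead_F => fE.
have R0 : R = 0.
  apply/eqP; apply: contraT => R0.
  have [|m [ls [lm uls sls lsE]]] := E_dense (_ : map_poly iota (lead_coef R) != 0).
    by rewrite map_neq0 // lead_coef_eq0.
  rewrite -lead_coef_ext in lm.
  have rls : all (root (fiber m (ext R))) ls.
    apply/allP => l /lsE Elm; rewrite /root -eval2_fiber.
    have := congr1 (fun h => eval2 (ext h) (l, m)) fE.
    rewrite -mul_polyC /ext rmorphM rmorphD rmorphM /= eval2M eval2D eval2M -!/(ext _).
    by rewrite (Ef _ Elm) (E_F Elm) !mulr0 add0r => <-.
  have := max_poly_roots (fiber_neq0 lm) rls uls.
  rewrite size_fiber // size_ext sls => sR.
  have : (size R < size F)%N by rewrite /R Pdiv.Idomain.ltn_modp.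
  by move: sR; rewrite ltnNge -ltnS => /negbTE;
    rewrite prednK ?size_poly_gt0 // => ->.
(* Now F divides a power of M times f; M is prime and does not divide F, whose fiber at M = 0 is
   nonzero. *)
apply: (@dvdr_cancel_primes _ (nseq (k * e) 'X)); last first.
  by rewrite big_nseq iter_mulr_1 exprM mul_polyC fE R0 addr0; exists Q;
    rewrite mulrC.
move=> _ /nseqP[-> _]; split.
  by have := @prime_XsubC D 0; rewrite subr0.
case=> g FE; case/negP: F_fiber0; rewrite FE rmorphM /= map_polyC /=.
by rewrite /horner_eval hornerX mul0r.
Qed.

End Vanishing.

(** * Components of plane curves *)

Section PlaneCurves.
Local Open Scope classical_set_scope.
Variable K : closedFieldType.
Implicit Types (f g P : {poly {poly K}}) (X Y Z : set (K * K)).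

Definition curve f : set (K * K) := [set x | eval2 f x = 0].

Lemma zero_locus1 f : zero_locus [set f] = curve f.
Proof. by apply/seteqP; split=> [x /(_ f erefl)//|x fx _ ->]. Qed.

Lemma curve_closed f : zariski_closed (curve f).
Proof. by exists [set f]; rewrite zero_locus1. Qed.

Lemma prime_dvd_of_subcurve P f : prime_elt P -> (1 < size P)%N ->
  curve P `<=` curve f -> dvdr P f.
Proof.
move=> pP sP Pf.
have idE g : map_poly (map_poly (idfun : K -> K)) g = g.
  by apply: map_poly_id => p _; rewrite map_poly_id.
by apply: (@prime_dvd_of_vanishing K K idfun) => // x; rewrite !idE; apply: Pf.
Qed.

Lemma curve_point P (c : {poly K}) : (1 < size P)%N -> c != 0 ->
  exists x, c.[x.2] != 0 /\ curve P x.
Proof.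
move=> sP c0; have lP0 : lead_coef P != 0.
  by rewrite lead_coef_eq0 -size_poly_gt0; case: size sP.
have /closed_nonrootP[m] : c * lead_coef P != 0 by rewrite mulf_neq0.
rewrite rootM negb_or => /andP[cm lm].
have [|l /eqP] := @closed_field_root K (fiber m P); first by rewrite size_fiber.
by rewrite -eval2_fiber => Pl; exists (l, m).
Qed.

Lemma not_subset_zero_locus X Y : zariski_closed Y -> ~ X `<=` Y ->
  exists f x, [/\ Y `<=` curve f, X x & eval2 f x != 0].
Proof.
move=> [F ->] /existsNP[x /not_implyP[Xx /existsNP[f /not_implyP[Ff fx]]]].
by exists f, x; split=> //; [move=> y; apply|apply/eqP].
Qed.

(** Polynomials f and g that vanish on Y and Z but not on the whole curve would have a product
    divisible by P. *)
Lemma prime_curve_irreducible P : prime_elt P -> (1 < size P)%N ->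
  irreducible_closed (curve P).
Proof.
move=> pP sP; split; first exact: curve_closed.
  by have [x [_ Px]] := curve_point sP (oner_neq0 _); exists x.
move=> Y Z Yc Zc YZ; apply: contrapT => /not_orP[nY nZ].
have [f [x [Yf Px /eqP fx]]] := not_subset_zero_locus Yc nY.
have [g [y [Zg Py /eqP gy]]] := not_subset_zero_locus Zc nZ.
have : dvdr P (f * g).
  apply: prime_dvd_of_subcurve => // z /YZ[/Yf|/Zg] fz;
    rewrite /curve /= eval2M.
    by rewrite [eval2 f z]fz mul0r.
  by rewrite [eval2 g z]fz mulr0.
case: pP => _ _ pP /pP[Pf|Pg].
  exact/fx/(eval2_dvdr Pf).
exact/gy/(eval2_dvdr Pg).
Qed.

Lemma irreducible_closed_sub_prod Y (s : seq {poly {poly K}}) :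
  irreducible_closed Y -> Y `<=` curve (\prod_(p <- s) p) ->
  exists2 p, p \in s & Y `<=` curve p.
Proof.
move=> [_ [y Yy] Yirr]; elim: s => [|p s IH].
  by move=> /(_ y Yy); rewrite /curve /= big_nil eval2C hornerC => /eqP;
    rewrite oner_eq0.
rewrite big_cons => Ys.
have [||x /Ys|Yp|/IH[q qs Yq]] := Yirr (curve p) (curve (\prod_(q <- s) q)).
- exact: curve_closed.
- exact: curve_closed.
- by rewrite /curve /= eval2M => /eqP; rewrite mulf_eq0 => /orP[]/eqP;
  [left|right].
- by exists p; rewrite ?mem_head.
by exists q; rewrite // inE qs orbT.
Qed.

Lemma irreducible_closed1 (x : K * K) : irreducible_closed [set x].
Proof.
split; last first.
- move=> Y Z _ _ /(_ x erefl)[Yx|Zx]; [left|right]; by move=> _ ->.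
- by exists x.
exists [set f | eval2 f x = 0]; apply/seteqP; split=> [_ -> f //|[l m] H].
have := H ('X - (x.1%:P)%:P); have := H ('X - x.2%:P)%:P.
rewrite /= !eval2_outer_sub !eval2_inner_sub !subrr /= => /(_ erefl) mE /(_ erefl) lE.
by rewrite (subr0_eq mE) (subr0_eq lE); case: x {H mE lE}.
Qed.

(** A polynomial vanishing on Y but not on the curve has a Bezout relation with P, whose constant
    lies in K[M] and vanishes on Y. Irreducibility confines Y to one line M = m, where the nonzero
    fiber of P leaves finitely many values of L. *)
Lemma irreducible_sub_prime_curve P Y : prime_elt P -> (1 < size P)%N ->
  (forall m, fiber m P != 0) ->
  irreducible_closed Y -> Y `<=` curve P -> Y <> curve P ->
  exists x, Y = [set x].
Proof.
move=> pP sP Pm Yirr YP YneP; have [Yc [y0 Yy0] _] := Yirr.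
have [|f [z [Yf Pz /eqP fz]]] := not_subset_zero_locus Yc (_ : ~ curve P `<=` Y).
  by move=> PY; apply: YneP; apply/seteqP.
have [|c [v [w [c0 cE]]]] := prime_poly_bezout pP sP (_ : ~ dvdr P f).
  by move=> Pf; apply/fz/(eval2_dvdr Pf).
have cY y : Y y -> c.[y.2] = 0.
  move=> Yy; rewrite -eval2C -cE eval2D !eval2M.
  by rewrite [eval2 P y](YP _ Yy) [eval2 f y](Yf _ Yy) !mulr0 addr0.
have [r cr] := closed_field_poly_normal c.
have [|_ /mapP[m _ ->] Ym] :=
    @irreducible_closed_sub_prod _ [seq ('X - m%:P)%:P | m <- r] Yirr.
  move=> y /cY; rewrite cr hornerZ => /eqP;
    rewrite mulf_eq0 lead_coef_eq0 (negPf c0) /=.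
  by move=> /eqP ry; rewrite /curve /= big_map -rmorph_prod eval2C.
have Y2 y : Y y -> y.2 = m.
  by move=> /Ym; rewrite /curve /= eval2_inner_sub => /eqP;
    rewrite subr_eq0 => /eqP.
have [t tE] := closed_field_poly_normal (fiber m P).
have [|_ /mapP[l _ ->] Yl] :=
    @irreducible_closed_sub_prod _ [seq ('X - l%:P%:P) | l <- t] Yirr.
  move=> [l m'] Yy; have /= mE := Y2 _ Yy; have := YP _ Yy.
  rewrite /curve /= !eval2_fiber mE tE hornerZ => /eqP.
  rewrite mulf_eq0 lead_coef_eq0 (negPf (Pm m)) /= => /eqP ry.
  rewrite big_map /fiber rmorph_prod -[RHS]ry; congr (_.[_]);
    apply: eq_bigr => z' _.
  by rewrite rmorphB /= map_polyX map_polyC /= /horner_eval hornerC.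
have Y1 y : Y y -> y.1 = l.
  move=> /Yl; rewrite /curve /= eval2_outer_sub => /eqP.
  by rewrite subr_eq0 => /eqP.
exists (l, m); apply/seteqP; split=> [[a b] Yab|_ ->].
  by have /= -> := Y1 _ Yab; have /= -> := Y2 _ Yab.
by move: (Yy0); have := Y1 _ Yy0; have := Y2 _ Yy0; case: (y0) => a b /= -> ->.
Qed.

Lemma prime_curve_krull_dim P : prime_elt P -> (1 < size P)%N ->
  (forall m, fiber m P != 0) -> krull_dim (curve P) 1.
Proof.
move=> pP sP Pm; have Pirr := prime_curve_irreducible pP sP; split.
  have [x [_ Px]] := curve_point sP (oner_neq0 _).
  (* A second point with another M-coordinate makes the chain strict. *)
  have xn0 : 'X - x.2%:P != 0 by rewrite polyXsubC_eq0.
  have [y [xy Py]] := curve_point sP xn0.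
  exists (fun i => if i is 0 then [set x] else curve P); split.
    case=> [|i] _; last by split.
    by split; [apply: irreducible_closed1|move=> _ ->].
  case=> // _; split=> [_ -> //|/(_ y Py)] /= xE.
  by move: xy; rewrite xE hornerXsubC subrr eqxx.
move=> [Y [Yirr Ysub]].
have [[i0 s0] [i1 s1] [i2 s2]] := And3 (Yirr 0%N isT) (Yirr 1%N isT) (Yirr 2%N isT).
have [[s01 n01] [s12 n12]] := (Ysub 0%N isT, Ysub 1%N isT).
(* The middle term of a longer chain is a proper irreducible subset, hence a point, with no room
   below it. *)
have [|x xE] := irreducible_sub_prime_curve pP sP Pm i1 s1.
  by move=> Y1; apply: n12; rewrite Y1; exact: s2.
case: i0 => _ [y0 Yy0] _; apply: n01; rewrite xE => _ ->.
by have := s01 _ Yy0; rewrite xE => <-.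
Qed.

(** The curve is the union of the curves of its prime factors, and each of these is a component of
    dimension one. *)
Lemma curve_one_dim f : (forall m, fiber m f != 0) ->
  one_dim_part (curve f) = curve f.
Proof.
move=> fm; apply/seteqP; split=> [x [Z [[_ Zf _] _ Zx]]|]; first exact: Zf.
have f0 : f != 0 by apply: contraNneq (fm 0) => ->; rewrite /fiber map_poly0.
have [s [u uu [sP fE]]] := factorial_poly (factorial_poly (@factorial_field K)) f0.
have dvdf p : p \in s -> dvdr p f.
  by move=> ps; rewrite fE (big_rem p) //=; apply/dvdr_mull/dvdr_mulr/dvdrr.
have nfib p : p \in s -> forall m, fiber m p != 0.
  move=> /dvdf[g fE'] m; apply: contraNneq (fm m) => pm.
  by rewrite fE' /fiber rmorphM /= [map_poly _ p]pm mul0r.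
(* A prime factor lying in K[M] would have a root m, and the fiber of f over m would vanish. *)
have size_s p : p \in s -> (1 < size p)%N.
  move=> ps; rewrite ltnNge; apply/negP => /size1_polyC pE.
  have [p0 pu _] := sP _ ps; move: (nfib _ ps) pu; rewrite pE.
  case: (leqP (size p`_0) 1) => [/size1_polyC qE pm|/closed_field_root[m /eqP pm]].
    rewrite qE; apply/negP; rewrite negbK !rmorph_unit // unitfE.
    by apply: contraNneq p0 => q0; rewrite pE qE q0 !rmorph0.
  by move=> /(_ m); rewrite /fiber map_polyC /= /horner_eval pm eqxx.
have fs : curve f `<=` curve (\prod_(p <- s) p).
  move=> x; rewrite /curve /= fE eval2M => /eqP;
    rewrite mulf_eq0 => /orP[]/eqP // ux.
  have := eval2M u^-1 u x; rewrite ux mulr0 mulVr // eval2C hornerC => /eqP.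
  by rewrite oner_eq0.
move=> x fx.
(* Since a point is irreducible, the same lemma selects a prime factor vanishing at x. *)
have [P Ps xP] := irreducible_closed_sub_prod (irreducible_closed1 x)
  (fun y (yx : [set x] y) => fs y (eq_ind_r (curve f) fx yx)).
have Pirr := prime_curve_irreducible (sP _ Ps) (size_s _ Ps).
exists (curve P); split; last exact: xP.
  split=> // [y|Y Yirr Yf PY]; first exact/eval2_dvdr/dvdf.
  have [Q Qs YQ] := irreducible_closed_sub_prod Yirr (subset_trans Yf fs).
  apply/seteqP; split=> // y /YQ Qy.
  have PQ : dvdr P Q.
    by apply: prime_dvd_of_subcurve (sP _ Ps) (size_s _ Ps) _ => z /PY/YQ.
  exact: (eval2_dvdr (prime_elt_assoc (sP _ Ps) (sP _ Qs) PQ)) Qy.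
exact: prime_curve_krull_dim (sP _ Ps) (size_s _ Ps) (nfib _ Ps).
Qed.

End PlaneCurves.

(** * A criterion for the A-polynomial *)

Section Characterization.
Local Open Scope classical_set_scope.
Variables (R : realType) (n : int) (F : {poly {poly int}}) (k : nat).
Local Notation C := (R[i]).
Local Notation E := (@eigenvalue_pairs R n).
Local Notation ext := (map_poly (map_poly (intr : int -> C))).
Hypothesis lead_F : lead_coef F = 'X^k.
Hypothesis F_fiber0 : map_poly (horner_eval 0) F != 0.
Hypothesis F_coef0 : F`_0 != 0.
Hypothesis E_dense : forall g : {poly C}, g != 0 -> exists m (ls : seq C),
  [/\ g.[m] != 0, uniq ls, size ls = (size F).-1 &
      forall l, l \in ls -> E (l, m)].
Hypothesis E_F : E `<=` @zero_set R F.

Let intrC_inj : injective (intr : int -> C).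
Proof. exact: intr_inj. Qed.

Let dvdr_F f : (forall x, E x -> eval2 (ext f) x = 0) -> dvdr F f.
Proof.
exact: (@dvdr_of_vanishing _ _ (intr : int -> C) intrC_inj F k E).
Qed.

Let fiber0_ext f : fiber 0 (ext f) = map_poly intr (map_poly (horner_eval 0) f).
Proof.
apply/polyP => i; rewrite /fiber !coef_map /= /horner_eval.
by rewrite !horner_coef0 coef_map.
Qed.

Let fiber0_neq0 : fiber 0 (ext F) != 0.
Proof. by rewrite fiber0_ext map_poly_eq0_id0 ?intr_eq0 ?lead_coef_eq0. Qed.

Let lead_ext : lead_coef (ext F) = 'X^k.
Proof.
by rewrite (lead_coef_ext (iota := intr : int -> C) intrC_inj) lead_F map_polyXn.
Qed.

Let fiber_ext m : fiber m (ext F) != 0.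
Proof.
have [->|m0] := eqVneq m 0; first exact: fiber0_neq0.
by apply: fiber_neq0; rewrite lead_ext hornerXn expf_neq0.
Qed.

(** A complex polynomial vanishing on the eigenvalue pairs is a multiple of F, by
    [dvdr_of_vanishing] with D the complex field. *)
Lemma closure_eigenvalue_pairs : zariski_closure E = curve (ext F).
Proof.
apply/seteqP; split=> [x|x Fx f Ef]; first by apply; apply: E_F.
have idE (g : {poly {poly C}}) : map_poly (map_poly (idfun : C -> C)) g = g.
  by apply: map_poly_id => p _; rewrite map_poly_id.
have sF : size (ext F) = size F by apply: (size_ext (iota := intr : int -> C)).
apply: (eval2_dvdr _ Fx).
apply: (@dvdr_of_vanishing C C idfun (@inj_id _) (ext F) k E) => //.
- by rewrite sF.
- by move=> x' /E_F; rewrite idE.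
- by move=> x' /Ef; rewrite idE.
Qed.

Lemma zero_set_one_dim : zero_set F = one_dim_part (zariski_closure E).
Proof. by rewrite closure_eigenvalue_pairs curve_one_dim. Qed.

Lemma poly_poly_int_unit (T : {poly {poly int}}) :
  T \is a GRing.unit -> T = 1 \/ T = -1.
Proof.
rewrite poly_unitE => /andP[/size_poly1P[c c0 ->]].
rewrite coefC /= poly_unitE => /andP[/size_poly1P[d d0 ->]].
rewrite coefC /= unit_intE => d1.
have /orP[/eqP->|/eqP->] : (d == 1) || (d == -1).
- by case: (d) d1 => [[|[|?]]|[|?]].
- by left.
by right; rewrite !polyCN.
Qed.

(** Squarefreeness: if F = Q^2 T, then Q T still vanishes on the pairs, so F divides it and Q is a
    unit. The content is one because the leading coefficient in L is a power of M. *)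
Theorem A_polynomial_of_dense : A_polynomial R n F.
Proof.
split; first exact: zero_set_one_dim.
- move=> Q [T FE]; have F0 : F != 0.
    by apply: contraNneq F_coef0 => ->; rewrite coef0.
  have [x Ex|S QT] := dvdr_F (f := Q * T).
    have := E_F Ex;
      rewrite /zero_set /= FE expr2 -mulrA rmorphM /= eval2M => /eqP.
    by rewrite mulf_eq0 => /orP[]/eqP // Q0; rewrite rmorphM /= eval2M Q0 mul0r.
  apply/unitrPr; exists S; apply: (mulfI F0).
  by rewrite mulr1 mulrCA -QT FE mulrA -expr2.
- move=> d dF; have := dF (size F).-1 k.
  by rewrite -lead_coefE lead_F coefXn eqxx dvdz1 => /eqP d1; rewrite -abszE d1.
- by case=> T FE; case/eqP: F_coef0; rewrite FE coefXM.
- case=> T FE; case/eqP: F_fiber0; rewrite FE rmorphM /= map_polyC /=.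
  by rewrite /horner_eval hornerX mul0r.
Qed.

(** F divides A. A prime P dividing the cofactor is excluded in each case: if it involves L, it
    divides F and A has a square factor; if it is a nonconstant element of Z[M], A vanishes on a
    line M = m that the zero set of F does not contain; if it is an integer, it divides the content
    of A. *)
Theorem A_polynomial_unique A : A_polynomial R n A -> A = F \/ A = - F.
Proof.
move=> [AZ Asq Acont _ _]; rewrite -zero_set_one_dim in AZ.
have A0 : A != 0.
  apply/eqP => A0; have dA i j : (0 %| A`_i`_j)%Z by rewrite A0 !coef0 dvdz0.
  by have /eqP := Acont 0 dA; rewrite normr0 eq_sym oner_eq0.
have AF x : eval2 (ext A) x = 0 -> eval2 (ext F) x = 0.
  by move=> Ax; have : zero_set A x by []; rewrite AZ.
have [x Ex|T AE] := dvdr_F (f := A).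
  by have := E_F Ex; rewrite -AZ.
have T0 : T != 0 by apply: contraNneq A0 => T0; rewrite AE T0 mulr0.
have [s [u uu [sP TE]]] := factorial_poly (factorial_poly factorial_int) T0.
case: s sP TE => [_|P s sP] TE.
  rewrite big_nil mulr1 in TE; rewrite AE TE.
  by have [->|->] := poly_poly_int_unit uu; [left; rewrite mulr1|right;
    rewrite mulrN1].
have pP := sP P (mem_head _ _).
have [T' TE'] : dvdr P T by rewrite TE big_cons mulrCA; eexists; reflexivity.
have [sP1|sP1] := leqP (size P) 1; last first.
  have [|S FE] := prime_dvd_of_vanishing intrC_inj pP sP1 (f := F).
    by move=> x Px; apply: AF;
      rewrite AE TE' !rmorphM /= !eval2M Px mul0r mulr0.
  have : P \is a GRing.unit by apply: Asq; exists (S * T');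
    rewrite AE FE TE' expr2 mulrACA.
  by case: pP => _ /negP.
have := size1_polyC sP1; set c := P`_0 => PE.
have [sc|sc] := leqP (size c) 1; last first.
  have [|m /eqP cm] := @closed_field_root C (map_poly intr c).
    by rewrite size_map_inj_poly //; apply: intrC_inj.
  have /closed_nonrootP[l /negP[]] := fiber_ext m.
  rewrite /root -eval2_fiber; apply/eqP/AF.
  by rewrite AE TE' PE !rmorphM /= !eval2M map_polyC /= eval2C cm mul0r mulr0.
have := size1_polyC sc; set d := c`_0 => cE.
have d1 : `|d| = 1.
  apply: Acont => i j; rewrite AE TE' mulrCA PE cE !coefCM; exact: dvdz_mulr.
case: pP => _ /negP[]; rewrite PE cE !rmorph_unit // unit_intE.
by rewrite -eqz_nat abszE d1.
Qed.
End Characterization.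

(** * Representations of the twist group *)

Section LinearRecurrence.
Variable R : comNzRingType.
Implicit Types x g : R.

Fixpoint lrec x g0 g1 k : R :=
  if k is k'.+1 then lrec x g1 (x * g1 - g0) k' else g0.

Lemma lrecSS x g0 g1 k : lrec x g0 g1 k.+2 = x * lrec x g0 g1 k.+1 - lrec x g0 g1 k.
Proof. by elim: k g0 g1 => [|k IH] g0 g1 //; rewrite [LHS]IH. Qed.

(** The Riley polynomial phi_n. Running its recurrence backwards from phi_0 = 1 and phi_1 = g gives
    phi_{-1} = x - g, and [Negz m] stands for -(m + 1). *)
Definition riley x g (n : int) : R :=
  match n with
  | Posz m => lrec x 1 g m
  | Negz m => lrec x 1 (x - g) m.+1
  end.
End LinearRecurrence.

Lemma subrACA_swap (V : zmodType) (a b c d : V) :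
  a - b - (c - d) = a - c - (b - d).
Proof. by rewrite !opprB [d - c]addrC [d - b]addrC addrACA. Qed.

(** * Powers of matrices by Cayley-Hamilton *)

Section MatrixPowers.
Variables (K : fieldType).
Implicit Types (A B W V : 'M[K]_2).

(** The hypothesis on [W + W^-1] is Cayley-Hamilton for determinant one and trace x. *)
Lemma exp_trace W x k : W \is a GRing.unit -> W + W^-1 = x%:A ->
  W ^+ k.+2 = x *: W ^+ k.+1 - W ^+ k.
Proof.
move=> uW E; have WW : W * W = x *: W - 1.
  have -> : x *: W = W * x%:A by rewrite -scalerAr mulr1.
  by rewrite -E mulrDr mulrV // addrK.
by rewrite !exprSr -mulrA WW mulrBr mulr1 -scalerAr.
Qed.

Lemma pow_rel A B W x g k : W \is a GRing.unit -> W + W^-1 = x%:A ->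
  A * W - W * B = g *: (A - B) ->
  A * W ^+ k - W ^+ k * B = lrec x 1 g k *: (A - B).
Proof.
move=> uW Wx h1; suff [] : A * W ^+ k - W ^+ k * B = lrec x 1 g k *: (A - B) /\
    A * W ^+ k.+1 - W ^+ k.+1 * B = lrec x 1 g k.+1 *: (A - B) by [].
elim: k => [|k [IH1 IH2]]; first by rewrite expr0 mulr1 mul1r scale1r expr1.
split=> //;
  rewrite (exp_trace k uW Wx) lrecSS mulrBr mulrBl -scalerAr -scalerAl.
rewrite scalerBl -scalerA -IH1 -IH2 scalerBr.
exact: subrACA_swap.
Qed.

Lemma zpow_rel A B W x g n : W \is a GRing.unit -> W + W^-1 = x%:A ->
  A * W - W * B = g *: (A - B) ->
  A * W ^ n - W ^ n * B = riley x g n *: (A - B).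
Proof.
move=> uW Wx h1; case: n => m; first exact: pow_rel.
rewrite NegzE -exprz_inv -[_ ^ _]/(W^-1 ^+ m.+1) /riley.
(* Replacing W by its inverse x - W changes g into x - g, the initial value for negative n. *)
have VE : W^-1 = x%:A - W by rewrite -Wx addrC addKr.
apply: pow_rel; [by rewrite unitrV|by rewrite invrK addrC|rewrite VE].
rewrite mulrBr mulrBl -scalerAr -scalerAl mulr1 mul1r scalerBl -h1 scalerBr.
exact: subrACA_swap.
Qed.

(** The same s and t serve both matrices because the recursion involves only the common x; this ties
    the powers of w to those of wbar. *)
Lemma pow_span W V x k : W \is a GRing.unit -> V \is a GRing.unit ->
  W + W^-1 = x%:A -> V + V^-1 = x%:A ->
  exists s t, W ^+ k = s *: W + t%:A /\ V ^+ k = s *: V + t%:A.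
Proof.
move=> uW uV Wx Vx; elim: k => [|k [s [t [WE VE]]]].
  by exists 0, 1; rewrite !scale0r !add0r scale1r.
exists (s * x + t), (- s); rewrite !exprSr WE VE !mulrDl -!scalerAl !mul1r.
have := exp_trace 0 uW Wx; have := exp_trace 0 uV Vx;
  rewrite expr0 !expr1 !expr2.
move=> -> ->; rewrite !scalerBr !scalerA !scalerDl scaleNr.
by split; rewrite addrAC.
Qed.

Lemma zpow_span W V x n : W \is a GRing.unit -> V \is a GRing.unit ->
  W + W^-1 = x%:A -> V + V^-1 = x%:A ->
  exists s t, W ^ n = s *: W + t%:A /\ V ^ n = s *: V + t%:A.
Proof.
move=> uW uV Wx Vx; case: n => m; first exact: (pow_span m uW uV Wx Vx).
rewrite NegzE -!exprz_inv -![_ ^ _]/(_ ^+ m.+1).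
have [||||s [t [-> ->]]] := @pow_span W^-1 V^-1 x m.+1;
  rewrite ?unitrV ?invrK //; try by rewrite addrC.
have inv_eq (Z : 'M[K]_2) : Z + Z^-1 = x%:A -> Z^-1 = x%:A - Z by move=> <-;
  rewrite addrC addKr.
exists (- s), (s * x + t); rewrite (inv_eq _ Wx) (inv_eq _ Vx).
by rewrite !scalerBr !scalerA scalerDl !scaleNr -!addrA; split; rewrite addrCA.
Qed.
End MatrixPowers.

Section Mx2.
Variable K : fieldType.
Definition mx2 (a b c d : K) : 'M[K]_2 :=
  \matrix_(i, j) (if i == 0 then if j == 0 then a else b
                  else if j == 0 then c else d).

Lemma mx2E a b c d :
  (mx2 a b c d 0 0 = a) * (mx2 a b c d 0 1 = b) *
  (mx2 a b c d 1 0 = c) * (mx2 a b c d 1 1 = d).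
Proof. by rewrite !mxE. Qed.

Lemma mx2_ext (A B : 'M[K]_2) : A 0 0 = B 0 0 -> A 0 1 = B 0 1 ->
  A 1 0 = B 1 0 -> A 1 1 = B 1 1 -> A = B.
Proof.
move=> h00 h01 h10 h11; apply/matrixP => i j.
have ord2 (k : 'I_2) : k = 0 \/ k = 1.
  by case: k => [[|[|//]] lk]; [left|right]; apply: val_inj.
by case: (ord2 i) => ->; case: (ord2 j) => ->.
Qed.

Lemma mx2_eta (A : 'M[K]_2) : A = mx2 (A 0 0) (A 0 1) (A 1 0) (A 1 1).
Proof. by apply: mx2_ext; rewrite mx2E. Qed.

Lemma mulmx2E (A B : 'M[K]_2) i j : (A * B) i j = A i 0 * B 0 j + A i 1 * B 1 j.
Proof. by rewrite mxE big_ord_recl big_ord1; congr (_ + A _ _ * B _ _);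
  apply: val_inj. Qed.

Lemma mulmx2 a b c d a' b' c' d' : mx2 a b c d * mx2 a' b' c' d' =
  mx2 (a * a' + b * c') (a * b' + b * d') (c * a' + d * c') (c * b' + d * d').
Proof. by apply: mx2_ext; rewrite mulmx2E !mx2E. Qed.

Lemma mx2_scalar a : a%:A = mx2 a 0 0 a.
Proof. by apply: mx2_ext; rewrite !mxE /= ?mulr1 ?mulr0. Qed.

Lemma mx2_1 : 1 = mx2 1 0 0 1 :> 'M[K]_2.
Proof. by rewrite -[LHS]scale1r mx2_scalar. Qed.

Lemma det_mx2 (A : 'M[K]_2) : \det A = A 0 0 * A 1 1 - A 0 1 * A 1 0.
Proof.
rewrite (expand_det_row _ 0) big_ord_recl big_ord1 /cofactor !det_mx11 !mxE /=.
have i1 : lift 0 0 = 1 :> 'I_2 by apply: val_inj.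
have i0 : lift 1 0 = 0 :> 'I_2 by apply: val_inj.
by rewrite !i1 !i0 /= expr0 expr1 mul1r mulN1r mulrN.
Qed.
End Mx2.

(** * Normal form of an irreducible representation *)

Section NormalForm.
Variables (K : fieldType) (M v s : K).
Hypothesis M0 : M != 0.

Let A := mx2 M v 0 M^-1.
Let B := mx2 M 0 s M^-1.
Let r := s * v.
Let u := (M - M^-1) ^+ 2.
Let x := 2 + r * (r + u).
Let g := 1 + r + u.
Let W : 'M[K]_2 := A * B^-1 * A^-1 * B.
Let V : 'M[K]_2 := B * A^-1 * B^-1 * A.

Lemma unit_inv_of (X Y : 'M[K]_2) : X * Y = 1 -> Y * X = 1 ->
  X \is a GRing.unit /\ X^-1 = Y.
Proof.
move=> XY YX; have uX : X \is a GRing.unit by apply/unitrP; exists Y.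
by split=> //; apply: (mulrI uX); rewrite XY mulrV.
Qed.

Lemma normal_A : A \is a GRing.unit /\ A^-1 = mx2 M^-1 (- v) 0 M.
Proof.
by apply: unit_inv_of; rewrite mulmx2 mx2_1; apply: mx2_ext; rewrite !mx2E;
  field.
Qed.

Lemma normal_B : B \is a GRing.unit /\ B^-1 = mx2 M^-1 0 (- s) M.
Proof.
by apply: unit_inv_of; rewrite mulmx2 mx2_1; apply: mx2_ext; rewrite !mx2E;
  field.
Qed.

Lemma normal_W_unit : W \is a GRing.unit /\ V \is a GRing.unit.
Proof.
have [[uA _] [uB _]] := (normal_A, normal_B).
by rewrite /W /V !unitrMl ?unitrV.
Qed.

Lemma normal_W_trace : W + W^-1 = x%:A /\ V + V^-1 = x%:A.
Proof.
have [[uA AE] [uB BE]] := (normal_A, normal_B).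
rewrite /W /V !invrM ?unitrMl ?unitrV // !invrK AE BE !mulmx2.
by split; apply: mx2_ext; rewrite !mxE /= /x /r /u; field.
Qed.

Lemma normal_rel : A * W - W * B = g *: (A - B).
Proof.
have [[uA AE] [uB BE]] := (normal_A, normal_B).
rewrite /W AE BE !mulmx2.
by apply: mx2_ext; rewrite !mxE /= /g /r /u; field.
Qed.

(** Here d is the determinant of [W - g%:A] by [normal_det], and N / d is the image of the longitude
    once the group relation holds. The second identity is then d times (M^2 - 1)(1 - L) = r (L +
    M^2). *)
Lemma normal_longitude : let N := (W - g%:A) * (V - g%:A) in
  let d := 1 - x * g + g ^+ 2 in
  N 1 0 = 0 /\ (M ^+ 2 - 1) * (d - N 0 0) = r * (N 0 0 + M ^+ 2 * d).
Proof.
have [[uA AE] [uB BE]] := (normal_A, normal_B).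
rewrite /= /W /V AE BE !mulmx2E !mulmx2 !mxE /= /g /x /r /u.
by split; field.
Qed.

Lemma normal_det : \det (W - g%:A) = 1 - x * g + g ^+ 2.
Proof.
have [[uA AE] [uB BE]] := (normal_A, normal_B).
rewrite det_mx2 /W /V AE BE !mulmx2 !mxE /= /g /x /r /u.
by field.
Qed.
End NormalForm.

Section SL2Representations.
Variables (R : realType) (G : groupType) (rho : G -> 'M[R[i]]_2).
Hypothesis rhoP : SL2_rep rho.

Lemma rep_unit g : rho g \is a GRing.unit.
Proof.
have : rho g \in unitmx by rewrite unitmxE; case: rhoP => _ ->; rewrite unitr1.
by [].
Qed.

Lemma repM g h : rho (g * h)%g = rho g * rho h.
Proof. by case: rhoP. Qed.

Lemma rep1 : rho 1%g = 1.
Proof. by apply: (mulrI (rep_unit 1%g)); rewrite -repM mulg1 mulr1. Qed.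

Lemma repV g : rho (g^-1)%g = (rho g)^-1.
Proof. by apply: (mulrI (rep_unit g));
  rewrite -repM mulgV rep1 mulrV // rep_unit. Qed.

Lemma repX g k : rho (g ^+ k)%g = rho g ^+ k.
Proof. by elim: k => [|k IH]; rewrite ?expg0 ?rep1 // expgS repM IH exprS. Qed.

Lemma rep_expgz g n : rho (expgz g n) = rho g ^ n.
Proof. by case: n => k; rewrite /expgz ?repV repX. Qed.

Lemma SL2_rep_conj (c : 'M[R[i]]_2) : c \is a GRing.unit ->
  SL2_rep (fun x => c * rho x * c^-1).
Proof.
move=> uc; split=> [x y|x].
  by rewrite repM -[_ *m _]/(_ * _) !mulrA mulrVK.
rewrite !det_mulmx -[c^-1]/(invmx c) det_inv; case: rhoP => _ ->.
by rewrite mulr1 divrr // -unitmxE.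
Qed.
End SL2Representations.

Lemma pres_ind (X : choiceType) (E : seq (X * bool) -> seq (X * bool) -> Prop)
    (P : presented E -> Prop) :
  P 1%g -> (forall g h, P g -> P h -> P (g * h)%g) ->
  (forall x, P (pres_gen E x)) -> (forall x, P (pres_gen E x)^-1%g) ->
  forall g, P g.
Proof.
move=> P1 PM Pg PV g; have [u ->] := pres_class_surj g.
elim: u => [|[y e] u IH]; first exact: P1.
rewrite -cat1s -pres_mulE; apply: PM IH.
case: e; first exact: Pg.
by have := PV y; rewrite /pres_gen -[(_ ^-1)%g]/(pres_inv _) pres_invE.
Qed.

Section TwistRepresentations.
Variables (R : realType) (n : int).
Local Notation C := (R[i]).
Implicit Types (rho : twist_group n -> 'M[C]_2) (M v s : C).

Definition riley_u M : C := (M - M^-1) ^+ 2.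
Definition riley_at (r u : C) : C := riley (2 + r * (r + u)) (1 + r + u) n.

Lemma normal_form_longitude M v s : M != 0 -> s != 0 ->
  let A := mx2 M v 0 M^-1 in let B := mx2 M 0 s M^-1 in
  let W := A * B^-1 * A^-1 * B in let V := B * A^-1 * B^-1 * A in
  let r := s * v in let L := (W ^ n * V ^ n) 0 0 in
  A * W ^ n = W ^ n * B -> \det (W ^ n) = 1 ->
  [/\ riley_at r (riley_u M) = 0, (W ^ n * V ^ n) 1 0 = 0 &
      (M ^+ 2 - 1) * (1 - L) = r * (L + M ^+ 2)].
Proof.
move=> M0 s0 A B W V r L AW detW.
pose u := riley_u M; pose x := 2 + r * (r + u); pose g := 1 + r + u.
have [uW uV] : W \is a GRing.unit /\ V \is a GRing.unit := normal_W_unit v s M0.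
have [Wx Vx] : W + W^-1 = x%:A /\ V + V^-1 = x%:A := normal_W_trace v s M0.
have rel : A * W - W * B = g *: (A - B) := normal_rel v s M0.
have AB_eq0 c : c *: (A - B) = 0 -> c = 0.
  move=> /matrixP/(_ 1 0)/eqP; rewrite !mxE /= sub0r mulrN oppr_eq0 mulf_eq0.
  by rewrite (negPf s0) orbF => /eqP.
have phi0 : riley_at r u = 0.
  by apply: AB_eq0; rewrite -(zpow_rel n uW Wx rel) AW subrr.
have [sg [t [WE VE]]] := zpow_span n uW uV Wx Vx.
(* Substituting w^n = sg w + t in a w^n = w^n b gives (sg g + t)(a - b) = 0, and a - b is nonzero
   because s is. *)
have tE : t = - (sg * g).
  apply/eqP; rewrite -addr_eq0 addrC; apply/eqP/AB_eq0.
  rewrite scalerDl -scalerA -rel; have := AW; rewrite WE mulrDr mulrDl.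
  move=> /eqP; rewrite -subr_eq0 -!scalerAr -!scalerAl mulr1 mul1r => /eqP <-.
  by rewrite !scalerBr opprD addrACA.
have fact Z : sg *: Z + t%:A = sg *: (Z - g%:A).
  by rewrite tE scalerBr scaleNr scalerA.
rewrite !fact in WE VE.
have [N10 N00] := normal_longitude v s M0; rewrite /= in N10 N00.
have dE : \det (W - g%:A) = 1 - x * g + g ^+ 2 := normal_det v s M0.
(* The determinant of w^n = sg (w - g) is 1; this fixes sg^2, which is all that enters the
   longitude. *)
have sd : sg ^+ 2 * (1 - x * g + g ^+ 2) = 1 by rewrite -dE -detZ -WE.
have lamE : W ^ n * V ^ n = sg ^+ 2 *: ((W - g%:A) * (V - g%:A)).
  by rewrite WE VE -scalerAl -scalerAr scalerA expr2.
split=> //; first by rewrite lamE mxE; apply/eqP; rewrite mulf_eq0; apply/orP;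
  right; apply/eqP; exact: N10.
have LE : L = sg ^+ 2 * ((W - g%:A) * (V - g%:A)) 0 0 by rewrite /L lamE mxE.
have := congr1 ( *%R (sg ^+ 2)) N00.
rewrite -/A -/B -/W -/V -/r -/(riley_u M) -/u -/x -/g.
rewrite mulrCA mulrBr sd -LE => ->; rewrite mulrCA mulrDr -LE;
  congr (_ * (_ + _)).
by rewrite mulrCA sd mulr1.
Qed.


Lemma rep_longitude rho : SL2_rep rho ->
  let A := rho (meridian_a n) in let B := rho (meridian_b n) in
  let W := A * B^-1 * A^-1 * B in let V := B * A^-1 * B^-1 * A in
  [/\ A * W ^ n = W ^ n * B, \det (W ^ n) = 1 &
      rho (longitude n) = W ^ n * V ^ n].
Proof.
move=> rhoP A B W V.
have wE : rho (twist_w n) = W by rewrite /twist_w !(repM rhoP) !(repV rhoP).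
have vE : rho (twist_wbar n) = V
  by rewrite /twist_wbar !(repM rhoP) !(repV rhoP).
split.
- have := congr1 rho (twist_group_rel n).
  by rewrite !(repM rhoP) (rep_expgz rhoP) wE.
- by rewrite -wE -(rep_expgz rhoP); case: rhoP.
by rewrite /longitude (repM rhoP) !(rep_expgz rhoP) wE vE.
Qed.

(** Otherwise both generators, hence the whole image, would be upper triangular and preserve the
    line spanned by the first basis vector. *)
Lemma irreducible_rep_lower rho : SL2_rep rho -> irreducible_rep rho ->
  rho (meridian_a n) 1 0 = 0 -> rho (meridian_b n) 1 0 <> 0.
Proof.
move=> rhoP irr A10 B10.
have upV (X : 'M[C]_2) : X \is a GRing.unit -> X 1 0 = 0 -> X^-1 1 0 = 0.
  move=> uX X10; have := mulrV uX => XV.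
  have := congr1 (fun Y : 'M[C]_2 => Y 1 0) XV.
  have := congr1 (fun Y : 'M[C]_2 => Y 1 1) XV.
  rewrite /= !mulmx2E X10 !mxE /= !mul0r !add0r => X11 /eqP.
  rewrite mulf_eq0 => /orP[/eqP x0|/eqP //].
  by move: X11 => /eqP; rewrite x0 mul0r eq_sym oner_eq0.
have up g : rho g 1 0 = 0.
  elim/pres_ind: g => [|g h IHg IHh|[]|[]].
  - by rewrite (rep1 rhoP) !mxE.
  - by rewrite (repM rhoP) mulmx2E IHg IHh mul0r mulr0 addr0.
  - exact: A10.
  - exact: B10.
  - by rewrite (repV rhoP); apply: upV A10; apply: rep_unit.
  - by rewrite (repV rhoP); apply: upV B10; apply: rep_unit.
pose e1 : 'cV[C]_2 := delta_mx 0 0; pose e2 : 'cV[C]_2 := delta_mx 1 0.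
have [g _ /vlineP[k ->]||] := irr <[e1]>%VS.
- rewrite -scalemxAr memvZ //; apply/vlineP; exists (rho g 0 0).
  rewrite -colE; apply/matrixP => i j; rewrite !mxE !ord1 eqxx andbT.
  have [->|->] : i = 0 \/ i = 1.
    by case: i => [[|[|//]] ?]; [left|right]; apply: val_inj.
  - by rewrite mulr1.
  - by rewrite up mulr0.
- move=> /eqP; rewrite -subv0 -memvE memv0 => /eqP/matrixP/(_ 0 0)/eqP.
  by rewrite !mxE oner_eq0.
move=> full; have /vlineP[k /matrixP/(_ 1 0)/eqP] : e2 \in <[e1]>%VS.
  by rewrite full memvf.
by rewrite !mxE mulr0 oner_eq0.
Qed.

Lemma eigenvalue_pair_equation l m : @eigenvalue_pairs R n (l, m) ->
  m != 0 /\ exists2 r, riley_at r (riley_u m) = 0 &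
    (m ^+ 2 - 1) * (1 - l) = r * (l + m ^+ 2).
Proof.
move=> [rho [rhoP irr upA upL [-> ->]]].
have A10 := upA 1 0 isT; have L10 := upL 1 0 isT.
set A := rho (meridian_a n) in A10 *; set B := rho (meridian_b n).
have /eqP s0 := irreducible_rep_lower rhoP irr A10; rewrite -/B in s0.
set M := A 0 0; set s := B 1 0 in s0.
have [AW detW lamE] := rep_longitude rhoP; rewrite -/A -/B in AW detW lamE.
have detA : M * A 1 1 = 1.
  by have [_ /(_ (meridian_a n))] := rhoP; rewrite det_mx2 A10 mulr0 subr0.
have M0 : M != 0 by apply/eqP => M0; move: detA; rewrite M0 mul0r => /eqP;
  rewrite eq_sym oner_eq0.
have A11 : A 1 1 = M^-1 by apply: (mulfI M0); rewrite detA divff.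
have uW : (A * B^-1 * A^-1 * B) ^ n \is a GRing.unit.
  have uA : A \is a GRing.unit by apply: rep_unit.
  have uB : B \is a GRing.unit by apply: rep_unit.
  by rewrite unitrXz // !unitrMl ?unitrV.
set Wn := _ ^ n in uW AW.
(* The relation conjugates a into b by w^n, so both have the same trace. *)
have trB : B 0 0 + B 1 1 = M + M^-1.
  have -> : B 0 0 + B 1 1 = \tr B.
    by rewrite /mxtrace big_ord_recl big_ord1; congr (_ + B _ _);
      apply: val_inj.
  have -> : B = Wn^-1 * (A * Wn) by rewrite AW mulKr.
  rewrite -[_ * _]/(_ *m _) mxtrace_mulC -[_ *m _]/(_ * _) mulrK //.
  by rewrite /mxtrace big_ord_recl big_ord1 -A11; congr (_ + A _ _);
    apply: val_inj.
have detB : B 0 0 * B 1 1 - B 0 1 * s = 1.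
  by have [_ /(_ (meridian_b n))] := rhoP; rewrite det_mx2.
(* Conjugating by the unipotent matrix with entry c adds c s to the upper-left entry of b and makes
   it M; trace and determinant then give the normal form. Upper triangular matrices keep their
   diagonal, so L and M are unchanged. *)
split=> //; pose c := (M - B 0 0) / s.
have [uc cV] : mx2 1 c 0 1 \is a GRing.unit /\ (mx2 1 c 0 1)^-1 = mx2 1 (- c) 0 1.
  by apply: unit_inv_of; rewrite mulmx2 mx2_1; apply: mx2_ext; rewrite !mx2E;
    ring.
have rhoP' := SL2_rep_conj rhoP uc.
have [] := rep_longitude rhoP'; rewrite -/A -/B cV.
have B11 : B 1 1 = M + M^-1 - B 0 0 by rewrite -trB addrC addKr.
have B01 : B 0 1 = (B 0 0 * B 1 1 - 1) / s.
  by apply: (mulIf s0); rewrite mulfVK // -detB opprB addrC subrK.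
have -> : mx2 1 c 0 1 * A * mx2 1 (- c) 0 1 = mx2 M (A 0 1 + c * (M^-1 - M)) 0 M^-1.
  rewrite [A]mx2_eta A10 A11 !mulmx2; apply: mx2_ext; rewrite !mx2E -/M; ring.
have -> : mx2 1 c 0 1 * B * mx2 1 (- c) 0 1 = mx2 M 0 s M^-1.
  rewrite [B]mx2_eta -/s !mulmx2; apply: mx2_ext; rewrite !mx2E.
  - by rewrite /c; field.
  - by rewrite B01 B11 /c; field; rewrite M0.
  - by ring.
  - by rewrite B11 /c; field; rewrite M0.
move=> AW' detW' lamE'.
have [phi0 N10 N00] := normal_form_longitude M0 s0 AW' detW'.
exists (s * (A 0 1 + c * (M^-1 - M))) => //; rewrite -lamE' in N00.
suff <- : (mx2 1 c 0 1 * rho (longitude n) * mx2 1 (- c) 0 1) 0 0 = rho (longitude n) 0 0 by [].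
by rewrite [rho _]mx2_eta L10 !mulmx2 !mx2E; ring.
Qed.
End TwistRepresentations.

(** * Representations defined on words in the generators *)

Section WordEvaluation.
Variables (R : realType) (n : int) (A B : 'M[R[i]]_2).
Hypotheses (detA : \det A = 1) (detB : \det B = 1).
Let W := A * B^-1 * A^-1 * B.
Hypothesis AW : A * W ^ n = W ^ n * B.

Definition letter_val (p : bool * bool) : 'M[R[i]]_2 :=
  let X := if p.1 then A else B in if p.2 then X else X^-1.

Definition word_val (u : seq (bool * bool)) : 'M[R[i]]_2 :=
  \prod_(p <- u) letter_val p.

Let det1_unit (X : 'M[R[i]]_2) : \det X = 1 -> X \is a GRing.unit.
Proof.
move=> detX; have : X \in unitmx by rewrite unitmxE detX unitr1.
by [].
Qed.

Let uA := det1_unit detA.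
Let uB := det1_unit detB.

Lemma letter_val_unit p : letter_val p \is a GRing.unit.
Proof. by case: p => [[] []]; rewrite /letter_val /= ?unitrV. Qed.

Lemma letter_valN x e : letter_val (x, ~~ e) = (letter_val (x, e))^-1.
Proof. by case: e; rewrite /letter_val //= invrK. Qed.

Lemma word_val_cat u v : word_val (u ++ v) = word_val u * word_val v.
Proof. by rewrite /word_val big_cat. Qed.

Lemma word_val1 p : word_val [:: p] = letter_val p.
Proof. by rewrite /word_val big_seq1. Qed.

Lemma word_val_unit u : word_val u \is a GRing.unit.
Proof.
elim: u => [|p u IH]; first by rewrite /word_val big_nil unitr1.
by rewrite -cat1s word_val_cat word_val1 unitrMl // letter_val_unit.
Qed.

Lemma word_val_inv u : word_val (winv u) = (word_val u)^-1.
Proof.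
elim: u => [|[x e] u IH]; first by rewrite /word_val /winv big_nil invr1.
rewrite -cat1s winv_cat !word_val_cat IH !word_val1 letter_valN.
by rewrite invrM ?letter_val_unit ?word_val_unit.
Qed.

Lemma word_val_nseq k u : word_val (flatten (nseq k u)) = word_val u ^+ k.
Proof.
elim: k => [|k IH]; first by rewrite /word_val big_nil.
by rewrite /= word_val_cat IH exprS.
Qed.

Lemma word_val_wexpz u m : word_val (wexpz u m) = word_val u ^ m.
Proof.
case: m => k; rewrite /wexpz word_val_nseq // word_val_inv NegzE.
by rewrite -exprz_inv.
Qed.

Lemma word_val_eq u v : pres_eq (twist_rel n) u v -> word_val u = word_val v.
Proof.
elim=> {u v} [u v [] | x e | u u' v v' _ IHu _ IHv | u | u v _ -> | u v t _ -> _ ->] //.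
- have wW : word_val ([:: (true, true)] ++ winv [:: (false, true)] ++
      winv [:: (true, true)] ++ [:: (false, true)]) = W.
    by rewrite !word_val_cat !word_val_inv !word_val1 !mulrA.
  rewrite !word_val_cat !word_val1 !word_val_wexpz wW.
  exact: AW.
-
  by rewrite -cat1s word_val_cat !word_val1 letter_valN mulrV ?letter_val_unit // /word_val big_nil.
- by rewrite !word_val_cat IHu IHv.
Qed.

Definition word_rep (g : twist_group n) : 'M[R[i]]_2 := word_val (repr g).

Lemma word_rep_class u : word_rep (pres_class (twist_rel n) u) = word_val u.
Proof. exact/word_val_eq/pres_repr. Qed.

Lemma word_rep_a : word_rep (meridian_a n) = A.
Proof. by rewrite /meridian_a /pres_gen word_rep_class word_val1. Qed.

Lemma word_rep_b : word_rep (meridian_b n) = B.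
Proof. by rewrite /meridian_b /pres_gen word_rep_class word_val1. Qed.

Lemma word_rep_SL2 : SL2_rep word_rep.
Proof.
split=> [g h|g].
  have [u ->] := pres_class_surj g; have [v ->] := pres_class_surj h.
  rewrite -[(_ * _)%g]/(pres_mul _ _) pres_mulE !word_rep_class.
  exact: word_val_cat.
rewrite /word_rep; elim: (repr g) => [|p u IH]; first
  by rewrite /word_val big_nil det1.
rewrite -cat1s word_val_cat word_val1 det_mulmx IH mulr1.
have detV (X : 'M[R[i]]_2) : \det X = 1 -> \det X^-1 = 1.
  by move=> X1; rewrite -[X^-1]/(invmx X) det_inv X1 invr1.
by case: p => [[] []]; rewrite /letter_val /= ?detV.
Qed.
End WordEvaluation.

Section MemEigenvaluePairs.
Variables (R : realType) (n : int).
Local Notation C := (R[i]).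
Implicit Types (M r : C).

(** Cramer's rule expresses any vector through v and w. *)
Lemma full_of_det (U : {vspace 'cV[C]_2}) (v w : 'cV[C]_2) :
  v \in U -> w \in U -> v 0 0 * w 1 0 - v 1 0 * w 0 0 != 0 -> U = fullv.
Proof.
move=> vU wU d0; apply/vspaceP => z; rewrite memvf.
move: d0; set d := _ - _ => d0;
  have dE : d = v 0 0 * w 1 0 - v 1 0 * w 0 0 by [].
clearbody d.
have -> : z = ((z 0 0 * w 1 0 - z 1 0 * w 0 0) / d) *: v
            + ((v 0 0 * z 1 0 - v 1 0 * z 0 0) / d) *: w.
  apply/matrixP => i j; rewrite !ord1 !mxE; apply: (mulIf d0).
  have [->|->] : i = 0 \/ i = 1.
    by case: i => [[|[|//]] ?]; [left|right]; apply: val_inj.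
  - by rewrite [in LHS]dE; field.
  - by rewrite [in LHS]dE; field.
by rewrite memvD // memvZ.
Qed.

(** The representation is the normal form with v = 1 and s = r; it is irreducible because r and r +
    u are nonzero. *)
Lemma mem_eigenvalue_pairs M r : M != 0 -> r != 0 -> r + riley_u M != 0 ->
  riley_at n r (riley_u M) = 0 ->
  exists l, @eigenvalue_pairs R n (l, M) /\
    (M ^+ 2 - 1) * (1 - l) = r * (l + M ^+ 2).
Proof.
move=> M0 r0 ru0 phi0.
pose A := mx2 M 1 0 M^-1; pose B := mx2 M 0 r M^-1.
have detA : \det A = 1 by rewrite det_mx2 !mx2E mulr0 subr0 divff.
have detB : \det B = 1 by rewrite det_mx2 !mx2E mul0r subr0 divff.
pose W := A * B^-1 * A^-1 * B.
have AW : A * W ^ n = W ^ n * B.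
  apply/eqP; rewrite -subr_eq0.
  have [uW _] := normal_W_unit 1 r M0; have [Wx _] := normal_W_trace 1 r M0.
  rewrite (zpow_rel n uW Wx (normal_rel 1 r M0)) mulr1.
  by rewrite [riley _ _ _]phi0 scale0r.
have rhoP := word_rep_SL2 detA detB AW.
have rhoA := word_rep_a detA detB AW.
have rhoB := word_rep_b detA detB AW.
set rho := word_rep _ _ in rhoP rhoA rhoB.
have [] := rep_longitude rhoP; rewrite rhoA rhoB => _ detW lamE.
have [_ N10] := normal_form_longitude M0 r0 AW detW.
rewrite -lamE mulr1 => N00; rewrite -lamE in N10.
exists (rho (longitude n) 0 0); split=> //.
exists rho; split=> //.
- move=> U Uinv; have [/eqP U0|U0] := boolP (vpick U == 0).
    by left; apply/eqP; rewrite -vpick0; apply/eqP.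
  right; set v := vpick U in U0.
  have vU : v \in U by apply: memv_pick.
  have AU := Uinv (meridian_a n) _ vU; have BU := Uinv (meridian_b n) _ vU.
  have mulE (X : 'M[C]_2) i : (X *m v) i 0 = X i 0 * v 0 0 + X i 1 * v 1 0.
    by rewrite mxE big_ord_recl big_ord1; congr (_ + X _ _ * v _ _);
      apply: val_inj.
  (* If v is not an eigenvector of both generators, v and one of its images span the plane. *)
  have [d1|] := eqVneq (v 0 0 * (rho (meridian_a n) *m v) 1 0
      - v 1 0 * (rho (meridian_a n) *m v) 0 0) 0; last exact: full_of_det.
  have [d2|] := eqVneq (v 0 0 * (rho (meridian_b n) *m v) 1 0
      - v 1 0 * (rho (meridian_b n) *m v) 0 0) 0; last exact: full_of_det.
  move: d1 d2; rewrite !mulE rhoA rhoB !mx2E => d1 d2.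
  case/negP: U0; apply/eqP/matrixP => i j; rewrite ord1 mxE.
  (* A common eigenvector off the first axis would force r + u = 0, and one on it would force r =
     0. *)
  have v1 : v 1 0 = 0.
    have /eqP : v 1 0 * ((M^-1 - M) * v 0 0 - v 1 0) = 0 by rewrite -d1; ring.
    rewrite mulf_eq0 => /orP[/eqP //|]; rewrite subr_eq0 => /eqP v1.
    have /eqP : v 0 0 * v 0 0 * (r + riley_u M) = 0.
      by rewrite /riley_u -d2 -v1; ring.
    by rewrite !mulf_eq0 (negPf ru0) orbF orbb -v1 => /eqP ->; rewrite mulr0.
  have v0 : v 0 0 = 0.
    have /eqP : v 0 0 * v 0 0 * r = 0 by rewrite -d2 v1; ring.
    by rewrite !mulf_eq0 (negPf r0) orbF orbb => /eqP.
  have [->|->] // : i = 0 \/ i = 1.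
  by case: i => [[|[|//]] ?]; [left|right]; apply: val_inj.
- rewrite rhoA => -[[|[|//]] ?] [[|[|//]] ?] // _.
  by rewrite !mxE.
- move=> [[|[|//]] i1] [[|[|//]] j1] // _; rewrite -[RHS]N10;
  congr (rho _ _ _); exact: val_inj.
by rewrite rhoA mx2E.
Qed.
End MemEigenvaluePairs.

(** * The Riley polynomial and the A-polynomial *)

Section HomogeneousRecurrence.
Variable R : comNzRingType.
Implicit Types y e g c x : R.

Fixpoint hrec y e g0 g1 k : R :=
  if k is k'.+1 then hrec y e g1 (y * g1 - e * g0) k' else g0.

(** Multiplying the k-th term by d^k turns x into d x and the coefficient 1 into d^2, so
    denominators clear within the recurrence. *)
Lemma hrec_lrec d x c g0 g1 k :
  hrec (d * x) (d ^+ 2) (c * g0) (c * d * g1) k = c * d ^+ k * lrec x g0 g1 k.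
Proof.
elim: k c g0 g1 => [|k IH] c g0 g1 /=; first by rewrite expr0 mulr1.
rewrite (_ : _ - _ = c * d * d * (x * g1 - g0)); last by ring.
by rewrite IH exprS mulrA.
Qed.

Lemma hrec0 y g0 g1 k : hrec y 0 g0 g1 k.+1 = y ^+ k * g1.
Proof.
elim: k g0 g1 => [|k IH] g0 g1; first by rewrite mul1r.
by rewrite [LHS]IH mul0r subr0 exprSr mulrA.
Qed.

Lemma hrec_cst g k : hrec 2 1 g g k = g.
Proof.
elim: k => [|k IH] //=; rewrite (_ : _ - _ = g) //; ring.
Qed.

Lemma lrec_hrec x g0 g1 k : lrec x g0 g1 k = hrec x 1 g0 g1 k.
Proof. by elim: k g0 g1 => [|k IH] g0 g1 //=; rewrite IH mul1r. Qed.

Lemma lrec_geometric x a b T T' k : T * T' = 1 -> x = T + T' ->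
  lrec x (a + b) (a * T + b * T') k = a * T ^+ k + b * T' ^+ k.
Proof.
move=> TT ->; elim: k a b => [|k IH] a b; first by rewrite !expr0 !mulr1.
rewrite /= (_ : _ - _ = (a * T) * T + (b * T') * T'); last first.
  rewrite -[a + b]mul1r -TT; ring.
by rewrite IH !exprS !mulrA.
Qed.

Lemma lrec_scale c x g0 g1 k : c * lrec x g0 g1 k = lrec x (c * g0) (c * g1) k.
Proof.
elim: k g0 g1 => [|k IH] g0 g1 //=; rewrite IH.
by rewrite mulrBr mulrCA.
Qed.

(* The recurrence of the Riley polynomial at r = (M^2 - 1)(1 - L) / (L + M^2),
   cleared of denominators, so that it makes sense in Z[M][L];
     see Aval_riley. *)
Definition Aval (L M : R) (n : int) : R :=
  let N := L + M ^+ 2 in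
  let D := N ^+ 2 * M ^+ 2 in
  let Y := 2 * D + (M ^+ 2 - 1) ^+ 2 * (1 - L) * (M ^+ 4 - L) in
  let G := L + M ^+ 6 in
  match n with
  | Posz 0 => 1
  | Posz m.+1 => hrec Y (D ^+ 2) G (Y * G - N ^+ 3 * M ^+ 4) m
  | Negz m => hrec Y (D ^+ 2) 1 (Y - N * G) m.+1
  end.

(** Both the degree of [Apoly n] in L and that of the Riley polynomial in r; this coincidence lets
    the roots r account for all the roots L. *)
Definition Adeg (n : int) : nat :=
  match n with Posz 0 => 0 | Posz m.+1 => (2 * m).+1 | Negz m => 2 * m.+1 end.
End HomogeneousRecurrence.

Lemma rmorph_hrec (R S : comNzRingType) (f : {rmorphism R -> S}) y e g0 g1 k :
  f (hrec y e g0 g1 k) = hrec (f y) (f e) (f g0) (f g1) k.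
Proof.
by elim: k g0 g1 => [|k IH] g0 g1 //=; rewrite IH rmorphB !rmorphM.
Qed.

Lemma rmorph_riley (R S : comNzRingType) (f : {rmorphism R -> S}) x g n :
  f (riley x g n) = riley (f x) (f g) n.
Proof.
by case: n => k; rewrite /riley !lrec_hrec rmorph_hrec ?rmorphB rmorph1.
Qed.

Lemma rmorph_Aval (R S : comNzRingType) (f : {rmorphism R -> S}) L M n :
  f (Aval L M n) = Aval (f L) (f M) n.
Proof.
case: n => [[|m]|m]; rewrite /Aval ?rmorph1 // rmorph_hrec;
  by rewrite ?(rmorphB, rmorphD, rmorphM, rmorphXn, rmorph1, rmorph_nat).
Qed.

Lemma Aval_riley (K : fieldType) (L M : K) n : M != 0 -> L + M ^+ 2 != 0 ->
  let r := (M ^+ 2 - 1) * (1 - L) / (L + M ^+ 2) in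
  let u := (M - M^-1) ^+ 2 in
  Aval L M n = M ^+ (2 * `|n|) * (L + M ^+ 2) ^+ Adeg n *
    riley (2 + r * (r + u)) (1 + r + u) n.
Proof.
move=> M0 N0 r u; rewrite /Aval; have LE : L = L + M ^+ 2 - M ^+ 2
  by rewrite addrK.
move: (L + M ^+ 2) N0 LE @r => N N0 LE r; pose D := N ^+ 2 * M ^+ 2.
pose x := 2 + r * (r + u); pose g := 1 + r + u.
have YE : 2 * D + (M ^+ 2 - 1) ^+ 2 * (1 - L) * (M ^+ 4 - L) = D * x.
  by rewrite /D /x /r /u LE; field; rewrite ?M0 ?N0.
have GE : L + M ^+ 6 = N * M ^+ 2 * g.
  by rewrite /g /r /u LE; field; rewrite ?M0 ?N0.
case: n => [[|m]|m]; rewrite -/D ?YE ?GE /Adeg.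
- by rewrite !expr0 !mul1r.
- rewrite (_ : _ - _ = N * M ^+ 2 * D * (x * g - 1)); last by rewrite /D; ring.
  rewrite hrec_lrec /riley /= -/x -/g; congr (_ * _).
  rewrite /D exprMn -!exprM mulnS exprD (exprS N (2 * m)).
  by move: (M ^+ (2 * m)) (N ^+ (2 * m)) => a b; ring.
rewrite (_ : _ - _ = 1 * D * (x - g)); last by rewrite /D; ring.
rewrite -[X in hrec _ _ X _](mulr1 1) hrec_lrec /riley -/x -/g mul1r.
by rewrite /D exprMn -!exprM [X in X * _]mulrC.
Qed.

(** * Leading coefficients along the recurrence *)

Section TopCoefficient.
Variable R : idomainType.
Implicit Types (f g : {poly R}) (c e : R).

(** A formal leading coefficient that may be zero, so that it passes through sums and products
    without cancellation cases and can be carried along [hrec]. *)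
Definition top_coef f d c : Prop := (size f <= d.+1)%N /\ f`_d = c.

Lemma top_coefC c : top_coef c%:P 0 c.
Proof. by split; rewrite ?size_polyC_leq1 ?coefC. Qed.

Lemma top_coefX : top_coef 'X 1 1.
Proof. by split; rewrite ?size_polyX ?coefX. Qed.

Lemma top_coefW f d : (size f <= d)%N -> top_coef f d 0.
Proof. by move=> sf; split; [apply: leqW|rewrite nth_default]. Qed.

Lemma top_coefD f g d c e : top_coef f d c -> top_coef g d e ->
  top_coef (f + g) d (c + e).
Proof.
move=> [sf <-] [sg <-]; split; last by rewrite coefD.
by rewrite (leq_trans (size_polyD _ _)) // geq_max sf.
Qed.

Lemma top_coefN f d c : top_coef f d c -> top_coef (- f) d (- c).
Proof. by move=> [sf <-]; split; rewrite ?size_polyN ?coefN. Qed.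

Lemma top_coefM f g d d' c e : top_coef f d c -> top_coef g d' e ->
  top_coef (f * g) (d + d') (c * e).
Proof.
move=> [sf <-] [sg <-]; split.
  rewrite (leq_trans (size_polyMleq _ _)) //.
  by rewrite -subn1 leq_subLR (leq_trans (leq_add sf sg)) // addSn addnS add1n.
rewrite coefM (bigD1 (inord d)) //= inordK ?ltnS ?leq_addr //.
rewrite addKn big1 ?addr0 // => i /eqP ni.
have [id|di] := ltnP i d.
  rewrite [g`_ _]nth_default ?mulr0 // (leq_trans sg) //.
  by rewrite ltn_subRL ltn_add2r.
have {}di : (d < i)%N.
  by rewrite ltn_neqAle di andbT; apply/eqP => E; apply: ni; apply: val_inj;
    rewrite /= inordK // ltnS leq_addr.
by rewrite [f`_ _]nth_default ?mul0r // (leq_trans sf).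
Qed.

Lemma top_coefXn f d c k : top_coef f d c -> top_coef (f ^+ k) (k * d) (c ^+ k).
Proof.
move=> fd; elim: k => [|k IH]; first by rewrite !expr0 -(rmorph1 polyC);
  apply: top_coefC.
by rewrite !exprS mulSn; apply: top_coefM.
Qed.

Lemma top_coef_eq f d c e : top_coef f d c -> c = e -> top_coef f d e.
Proof. by move=> fc <-. Qed.

Lemma top_coef_lead f d c : top_coef f d c -> c != 0 ->
  size f = d.+1 /\ lead_coef f = c.
Proof.
move=> [sf <-] c0; have sfE : size f = d.+1.
  by apply/eqP; rewrite eqn_leq sf ltnNge; apply: contra c0 => ?;
    rewrite nth_default.
by rewrite lead_coefE sfE.
Qed.

Lemma top_coef_hrec (y e g0 g1 : {poly R}) dy d0 y' e' c0 c1 k :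
  top_coef y dy y' -> top_coef e (dy + dy) e' ->
  top_coef g0 d0 c0 -> top_coef g1 (dy + d0) c1 ->
  top_coef (hrec y e g0 g1 k) (k * dy + d0) (hrec y' e' c0 c1 k).
Proof.
move=> yP eP; elim: k g0 g1 d0 c0 c1 => [|k IH] g0 g1 d0 c0 c1 g0P g1P //=.
rewrite mulSn [(dy + k * dy)%N]addnC -addnA.
apply: IH => //; apply: top_coefD; first exact: top_coefM.
by rewrite addnA; apply/top_coefN/top_coefM.
Qed.
End TopCoefficient.

Definition Apoly (n : int) : {poly {poly int}} := Aval polyL polyM n.

Lemma Apoly_lead n : exists k, size (Apoly n) = (Adeg n).+1 /\
  lead_coef (Apoly n) = 'X^k.
Proof.
pose L : {poly {poly int}} := polyL; pose M : {poly {poly int}} := polyM.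
have MP j : top_coef (M ^+ j) 0 ('X^j).
  by rewrite /M /polyM -rmorphXn; apply: top_coefC.
have LP : top_coef L 1 1 by apply: top_coefX.
have cP (f : {poly int}) : top_coef f%:P 1 0.
  by apply: top_coefW; rewrite size_polyC_leq1.
have MP1 j : top_coef (M ^+ j) 1 0.
  by rewrite /M /polyM -rmorphXn; apply: cP.
have oneP : top_coef (1 : {poly {poly int}}) 1 0 by have := cP 1;
  rewrite polyC1.
have one0P : top_coef (1 : {poly {poly int}}) 0 1 by have :=
  top_coefC (1 : {poly int}); rewrite polyC1.
have NP : top_coef (L + M ^+ 2) 1 1.
  by rewrite -[X in top_coef _ _ X]addr0; apply: top_coefD.
have GP : top_coef (L + M ^+ 6) 1 1.
  by rewrite -[X in top_coef _ _ X]addr0; apply: top_coefD.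
have DP : top_coef ((L + M ^+ 2) ^+ 2 * M ^+ 2) 2 'X^2.
  by have := top_coefM (top_coefXn 2 NP) (MP 2%N); rewrite expr1n mul1r.
have YP : top_coef (2 * ((L + M ^+ 2) ^+ 2 * M ^+ 2) + (M ^+ 2 - 1) ^+ 2 * (1 - L) * (M ^+ 4 - L))
    2 ('X^4 + 1).
  have p1 : top_coef (1 - L) 1 (- 1).
    by rewrite -[X in top_coef _ _ X]add0r; apply/top_coefD/top_coefN.
  have p2 : top_coef (M ^+ 4 - L) 1 (- 1).
    by rewrite -[X in top_coef _ _ X]add0r; apply/top_coefD/top_coefN.
  have p3 : top_coef (M ^+ 2 - 1) 0 ('X^2 - 1) by apply/top_coefD/top_coefN.
  have two : top_coef (2 : {poly {poly int}}) 0 2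
    by apply: (top_coefD one0P one0P).
  apply: top_coef_eq
    (top_coefD (top_coefM two DP) (top_coefM (top_coefM (top_coefXn 2 p3) p1) p2)) _.
  by ring.
have EP : top_coef (((L + M ^+ 2) ^+ 2 * M ^+ 2) ^+ 2) (2 + 2) 'X^4.
  by apply: top_coef_eq (top_coefXn 2 DP) _; rewrite -exprM.
(* The leading coefficients obey a recurrence with characteristic roots 1 and M^4, and the initial
   values single out the powers of one root. *)
have t0 k : hrec ('X^4 + 1) ('X^4) (1 : {poly int}) 1 k = 1.
  elim: k => [|k IH] //=; rewrite (_ : _ - _ = 1) //; ring.
have tX k : hrec ('X^4 + 1) ('X^4) (1 : {poly int}) 'X^4 k = 'X^(4 * k).
  have gen c : hrec ('X^4 + 1) ('X^4) c ('X^4 * c) k = c * ('X^(4 * k) : {poly int}).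
    elim: k c => [|k IH] c; first by rewrite muln0 expr0 mulr1.
    rewrite /= (_ : _ - _ = 'X^4 * ('X^4 * c)); last by ring.
    by rewrite IH mulnS exprD; ring.
  by have := gen 1; rewrite mulr1 mul1r.
rewrite /Apoly; case: n => [[|m]|m]; rewrite /Aval /Adeg -/L -/M.
- by exists 0%N; rewrite size_poly1 lead_coef1.
- exists 0%N; apply: top_coef_lead; last by rewrite expr0 oner_neq0.
  have h1 : top_coef ((2 * ((L + M ^+ 2) ^+ 2 * M ^+ 2)
      + (M ^+ 2 - 1) ^+ 2 * (1 - L) * (M ^+ 4 - L)) * (L + M ^+ 6)
      - (L + M ^+ 2) ^+ 3 * M ^+ 4) (2 + 1) 1.
    apply: top_coef_eq
      (top_coefD (top_coefM YP GP) (top_coefN (top_coefM (top_coefXn 3 NP) (MP 4%N)))) _.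
    by ring.
  by have := top_coef_hrec m YP EP GP h1; rewrite t0 addn1 mulnC.
exists (4 * m.+1)%N; apply: top_coef_lead; last
  by rewrite -size_poly_eq0 size_polyXn.
have h1 : top_coef (2 * ((L + M ^+ 2) ^+ 2 * M ^+ 2)
    + (M ^+ 2 - 1) ^+ 2 * (1 - L) * (M ^+ 4 - L)
    - (L + M ^+ 2) * (L + M ^+ 6)) (2 + 0) 'X^4.
  by apply: top_coef_eq (top_coefD YP (top_coefN (top_coefM NP GP))) _; ring.
by have := top_coef_hrec m.+1 YP EP one0P h1; rewrite tX addn0 mulnC.
Qed.

(** At M = 0 the quantity D vanishes, and the recurrence becomes geometric with ratio L (L - 1). *)
Lemma Apoly_fiber0 n : map_poly (horner_eval 0) (Apoly n) != 0.
Proof.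
rewrite /Apoly rmorph_Aval /= map_polyX map_polyC /= /horner_eval hornerX polyC0.
have X1 : ('X - 1 : {poly int}) != 0 by rewrite -polyC1 polyXsubC_eq0.
have X0 : ('X : {poly int}) != 0 by rewrite polyX_eq0.
case: n => [[|m]|m]; rewrite ?oner_neq0 //.
  have -> : Aval 'X 0 (Posz m.+1) = hrec (('X - 1) * 'X) 0 'X (('X - 1) * 'X ^+ 2) m :> {poly int}.
    by rewrite /Aval; congr (hrec _ _ _ _ _); ring.
  by case: m => [|m]; rewrite ?hrec0 // !mulf_neq0 ?expf_neq0 ?mulf_neq0.
have -> : Aval 'X 0 (Negz m) = hrec (('X - 1) * 'X) 0 1 (- 'X) m.+1 :> {poly int}.
  by rewrite /Aval; congr (hrec _ _ _ _ _); ring.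
by rewrite hrec0 mulf_neq0 ?oppr_eq0 ?expf_neq0 ?mulf_neq0.
Qed.

(** At this point the recurrence has Y = 2 and D = 1, hence constant solutions; the value shows that
    the constant term of [Apoly n] in L is nonzero. *)
Lemma Aval01 (R : comNzRingType) n : Aval (0 : R) 1 n = 1.
Proof.
case: n => [[|m]|m] //.
  rewrite -[RHS](hrec_cst 1 m) /Aval; congr (hrec _ _ _ _ _); ring.
rewrite -[RHS](hrec_cst 1 m.+1) /Aval; congr (hrec _ _ _ _ _); ring.
Qed.

Lemma Apoly_coef0 n : (Apoly n)`_0 != 0.
Proof.
have : (horner_eval 1 \o horner_eval 0) (Apoly n) = 1.
  rewrite /Apoly /= -[horner_eval 1 _]/((horner_eval 1 \o horner_eval 0) _) rmorph_Aval /=.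
  by rewrite /horner_eval hornerX !hornerC hornerX Aval01.
by rewrite /= /horner_eval horner_coef0; apply: contraPneq => ->;
  rewrite horner0 => /eqP; rewrite eq_sym oner_eq0.
Qed.

Lemma eval2_Apoly (K : comNzRingType) n (x : K * K) :
  eval2 (map_poly (map_poly (intr : int -> K)) (Apoly n)) x = Aval x.1 x.2 n.
Proof.
rewrite /eval2 /Apoly rmorph_Aval /=.
rewrite -[_.[_]]/(horner_eval _ _) -[X in horner_eval _ X]/(horner_eval _ _).
rewrite !rmorph_Aval /= map_polyX map_polyC /= map_polyX /horner_eval.
by rewrite hornerX !hornerC hornerX.
Qed.

(** * Roots of the Riley polynomial *)

Section RileyPolynomial.
Variables (C : numClosedFieldType) (n : int).

Definition riley_poly (u : C) : {poly C} :=
  riley (2 + 'X * ('X + u%:P)) (1 + 'X + u%:P) n.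

(** The outer indeterminate is r and the inner one is u. *)
Definition riley_poly2 : {poly {poly C}} :=
  riley (2 + 'X * ('X + 'X%:P)) (1 + 'X + 'X%:P) n.

Lemma horner_riley_poly u r :
  (riley_poly u).[r] = riley (2 + r * (r + u)) (1 + r + u) n.
Proof.
rewrite -[LHS]/(horner_eval r (riley_poly u)) rmorph_riley /=.
by congr (riley _ _ _); rewrite /horner_eval !hornerE.
Qed.

Lemma fiber_riley_poly2 u : fiber u riley_poly2 = riley_poly u.
Proof.
rewrite /fiber rmorph_riley !(rmorphD, rmorphM, rmorph1) /=.
by rewrite map_polyX map_polyC /= /horner_eval hornerX.
Qed.

Lemma top_coef_riley (D : idomainType) (c : D) :
  top_coef (riley (2 + 'X * ('X + c%:P)) (1 + 'X + c%:P) n) (Adeg n) 1.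
Proof.
have XP := top_coefX D.
have CP (a : D) : top_coef a%:P 1 0 by apply: top_coefW;
  rewrite size_polyC_leq1.
have uP := CP c.
have XuP : top_coef ('X + c%:P) 1 1.
  by apply: top_coef_eq (top_coefD XP uP) _; rewrite addr0.
have oneP : top_coef (1 : {poly D}) 1 0 by have := CP 1; rewrite polyC1.
have one0P : top_coef (1 : {poly D}) 0 1 by have := top_coefC (1 : D);
  rewrite polyC1.
have one4 : top_coef (1 : {poly D}) 4 0 by apply: top_coefW; rewrite size_poly1.
have two : top_coef (2 : {poly D}) 2 0.
  by apply: top_coefW; rewrite -polyC_natr (leq_trans (size_polyC_leq1 _)).
have xP : top_coef (2 + 'X * ('X + c%:P)) 2 1.
  by apply: top_coef_eq (top_coefD two (top_coefM XP XuP)) _;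
    rewrite add0r mulr1.
have gP : top_coef (1 + 'X + c%:P) 1 1.
  by apply: top_coef_eq (top_coefD (top_coefD oneP XP) uP) _;
    rewrite add0r addr0.
have gP2 : top_coef (1 + 'X + c%:P) 2 0.
  by case: gP => sg _; apply: top_coefW.
(* The polynomial 1 has coefficient 0 in degree 4, so the leading coefficients follow a recurrence
   with constant solutions. *)
have cst k (a : D) : hrec 1 0 a a k = a.
  by elim: k => [|k IH] //=; rewrite mul1r mul0r subr0.
case: n => [[|m]|m]; rewrite /riley lrec_hrec.
- exact: one0P.
- have h1 : top_coef ((2 + 'X * ('X + c%:P)) * (1 + 'X + c%:P) - 1 * 1) (2 + 1) 1.
    apply: top_coef_eq (top_coefD (top_coefM xP gP) (top_coefN (top_coefW (_ : (size (1 * 1 : {poly D})%R <= _)%N)))) _.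
      by rewrite mulr1 size_poly1.
    by rewrite mulr1 subr0.
  by have := top_coef_hrec m xP one4 gP h1; rewrite cst /= addn1 mulnC.
have h1 : top_coef (2 + 'X * ('X + c%:P) - (1 + 'X + c%:P)) (2 + 0) 1.
  by apply: top_coef_eq (top_coefD xP (top_coefN gP2)) _; rewrite subr0.
by have := top_coef_hrec m.+1 xP one4 one0P h1; rewrite cst addn0 mulnC.
Qed.

Lemma riley_poly_monic u : size (riley_poly u) = (Adeg n).+1 /\ lead_coef (riley_poly u) = 1.
Proof. by apply: top_coef_lead (top_coef_riley _) _; rewrite oner_neq0. Qed.

(* At u = -4, i.e. M = i, the irreducible representations are dihedral. *)
Lemma riley_poly_dihedral t : t != 0 -> t ^+ (2 * Adeg n).+1 = 1 -> t != 1 ->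
  root (riley_poly (-4)) (2 - (t + t^-1)).
Proof.
move=> t0 tE t1; rewrite /root horner_riley_poly.
have tt : t - 1 != 0 by rewrite subr_eq0.
apply/eqP; apply: (mulfI tt); rewrite mulr0.
set x := 2 + _; set g := 1 + _ + _.
have xE : x = t ^+ 2 + t ^- 2 by rewrite /x; field.
have gE : (t - 1) * g = - 1 * t ^+ 2 + t * t ^- 2 by rewrite /g; field.
have TT : t ^+ 2 * t ^- 2 = 1 by rewrite divff // expf_neq0.
case: n tE => [[|m]|m]; rewrite /riley /Adeg => tE.
- by move: t1; rewrite -tE eqxx.
- rewrite lrec_scale mulr1 gE [t - 1]addrC (lrec_geometric _ _ _ TT xE).
  apply: (mulfI (expf_neq0 (2 * m.+1) t0)); rewrite mulr0 mulrDr exprVn -exprM.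
  rewrite [_ * (t * _)]mulrCA divff ?expf_neq0 // mulN1r mulrN -exprD mulr1.
  apply/eqP; rewrite addrC subr_eq0; apply/eqP.
  rewrite -[LHS]mulr1 -tE -exprS; congr (_ ^+ _); lia.
have g'E : (t - 1) * (x - g) = t * t ^+ 2 + - 1 * t ^- 2.
  by rewrite mulrBr gE xE; field.
rewrite lrec_scale mulr1 g'E (lrec_geometric _ _ _ TT xE).
apply: (mulfI (expf_neq0 (2 * m.+1) t0)); rewrite mulr0 mulrDr exprVn -exprM.
rewrite mulN1r mulrN divff ?expf_neq0 // mulrCA -exprD -exprS.
apply/eqP; rewrite subr_eq0 -tE; apply/eqP; congr (_ ^+ _); lia.
Qed.

(** A count of the t shows that the r are distinct. With r = 2 - t - 1/t, the factor X^2 - (2 - r) X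
    + 1 has roots t and 1/t. So P, of degree twice the number of distinct r, vanishes at the 2d
    nontrivial roots of unity t with t^(2d+1) = 1, which leaves at least d distinct r. *)
Lemma riley_poly_dihedral_roots :
  exists rs : seq C, [/\ uniq rs,
    size rs = Adeg n & all (root (riley_poly (-4))) rs].
Proof.
set d := Adeg n; pose e := (2 * d).+1.
have [sQ lQ] := riley_poly_monic (-4); set Q := riley_poly _ in sQ lQ *.
have Q0 : Q != 0 by rewrite -lead_coef_eq0 lQ oner_neq0.
have [rs QE] := closed_field_poly_normal Q.
rewrite lQ scale1r in QE.
have srs : size rs = d by move: sQ; rewrite QE size_prod_XsubC => -[].
have rsP r : root Q r = (r \in rs) by rewrite QE root_prod_XsubC.
have [ts TE] := closed_field_poly_normal ('X^e - 1 : {poly C}).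
rewrite lead_coefXnsubC // scale1r in TE.
have sts : size ts = e.
  by apply: succn_inj; rewrite -(size_prod_XsubC ts id) -TE size_XnsubC.
have uts : uniq ts.
  by rewrite -separable_prod_XsubC -TE separable_Xn_sub_1 // pnatr_eq0.
have tsP t : t \in ts -> t ^+ e = 1.
  by rewrite -(root_prod_XsubC ts) -TE rootE !hornerE subr_eq0 => /eqP.
have t1 : 1 \in ts by rewrite -root_prod_XsubC -TE rootE !hornerE expr1n subrr.
pose zs := undup rs.
pose P := \prod_(r <- zs) ('X^2 - (2 - r)%:P * 'X + 1).
have sP1 (a : C) : size ('X^2 - a%:P * 'X + 1) = 3.
  have [s1 _] := top_coefM (top_coefC a) (top_coefX C).
  have s0 : (size (1 : {poly C})%R <= 2)%N by rewrite size_poly1.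
  have :=
    top_coefD (top_coefD (top_coefXn 2 (top_coefX C)) (top_coefN (top_coefW s1)))
    (top_coefW s0).
  rewrite subr0 addr0 expr1n => /top_coef_lead.
  by rewrite oner_neq0 => /(_ isT)[].
have sP : size P = (2 * size zs).+1.
  rewrite /P; elim: (zs) => [|z zs' IH]; first by rewrite big_nil size_poly1.
  have := sP1 (2 - z); set p := 'X^2 - _ + _ => sp.
  have p0 : p != 0 by rewrite -size_poly_eq0 sp.
  rewrite big_cons size_mul // ?sp ?IH; first by rewrite /= mulnS.
  by rewrite -size_poly_eq0 IH.
have P0 : P != 0 by rewrite -size_poly_eq0 sP.
have rem_roots : all (root P) (rem 1 ts).
  apply/allP => t; rewrite mem_rem_uniq // inE => /andP[tn1 /tsP te].
  have t0 : t != 0 by apply/eqP => t0; move: te; rewrite t0 expr0n => /eqP;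
    rewrite eq_sym oner_eq0.
  have := riley_poly_dihedral t0 te tn1; rewrite rsP => zr.
  rewrite /P (big_rem (2 - (t + t^-1))) ?mem_undup //= rootM; apply/orP; left.
  by rewrite rootE !hornerE; apply/eqP; field.
have := max_poly_roots P0 rem_roots (rem_uniq _ uts).
rewrite size_rem // sts sP ltnS leq_mul2l /= => dz.
have uz : size zs = size rs.
  by apply/eqP; rewrite eqn_leq size_undup srs.
exists rs; split=> //; last by apply/allP => r; rewrite rsP.
by have := ltn_size_undup rs; rewrite -/zs uz ltnn => /esym/negbFE.
Qed.

(** The witness b is the resultant of phi_n and its derivative in r, nonzero because phi_n is
    separable at u = -4. *)
Lemma riley_poly_generic_roots : exists2 b : {poly C}, b != 0 &
  forall u, b.[u] != 0 -> exists rs : seq C,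
    [/\ uniq rs, size rs = Adeg n & all (root (riley_poly u)) rs].
Proof.
have [d0|d0] := posnP (Adeg n).
  by exists 1; rewrite ?oner_neq0 // => u _; exists [::]; rewrite d0.
have [sQ lQ] : size riley_poly2 = (Adeg n).+1 /\ lead_coef riley_poly2 = 1.
  by apply: top_coef_lead (top_coef_riley _) _; rewrite oner_neq0.
have Q0 : riley_poly2 != 0 by rewrite -lead_coef_eq0 lQ oner_neq0.
have lQ' : lead_coef riley_poly2^`() = (Adeg n)%:R.
  have c0 : (Adeg n)%:R != 0 :> {poly C}
    by rewrite -polyC_natr polyC_eq0 pnatr_eq0 -lt0n.
  have [|_ //] := @top_coef_lead _ riley_poly2^`() (Adeg n).-1 _ _ c0.
  split; first by rewrite prednK // -ltnS -sQ lt_size_deriv.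
  by rewrite coef_deriv prednK // -[X in X *+ _]/(nth 0 riley_poly2 (Adeg n).+1.-1) -sQ -lead_coefE lQ.
have resE u : (resultant riley_poly2 riley_poly2^`()).[u]
    = resultant (riley_poly u) (riley_poly u)^`().
  (* The resultant commutes with specializing u because the leading coefficients, 1 and [Adeg n], do
     not vanish. *)
  have := @map_resultant _ _ (horner_eval u) riley_poly2 riley_poly2^`().
  rewrite lQ lQ' /= /horner_eval hornerC oner_neq0 -polyC_natr hornerC pnatr_eq0 -lt0n d0.
  by move=> /(_ isT isT) ->;
    rewrite -!/(fiber _ _) /fiber -deriv_map -fiber_riley_poly2.
have sep_res u : separable_poly (riley_poly u) =
    ((resultant riley_poly2 riley_poly2^`()).[u] != 0).
  rewrite resE resultant_eq0 unlock coprimep_def -leqNgt eqn_leq.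
  rewrite andb_idr // size_poly_gt0 gcdp_eq0 -lead_coef_eq0.
  by have [_ ->] := riley_poly_monic u; rewrite oner_eq0.
have roots u : exists rs,
  size rs = Adeg n /\ riley_poly u = \prod_(r <- rs) ('X - r%:P).
  have [su lu] := riley_poly_monic u;
    have [rs QE] := closed_field_poly_normal (riley_poly u).
  rewrite lu scale1r in QE; exists rs; split=> //.
  by move: su; rewrite QE size_prod_XsubC => -[].
exists (resultant riley_poly2 riley_poly2^`()).
  suff : (resultant riley_poly2 riley_poly2^`()).[-4] != 0.
    by apply: contraNneq => ->; rewrite horner0.
  have [rs [urs srs rts]] := riley_poly_dihedral_roots.
  rewrite -sep_res; have [rs' [srs' QE]] := roots (-4);
    rewrite QE separable_prod_XsubC.
  apply: (leq_size_uniq urs) => [r /(allP rts)|]; last by rewrite srs srs'.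
  by rewrite QE root_prod_XsubC.
move=> u; rewrite -sep_res; have [rs [srs ->]] := roots u.
rewrite separable_prod_XsubC => urs; exists rs; split=> //.
by apply/allP => r; rewrite root_prod_XsubC.
Qed.

End RileyPolynomial.

(** If r + u = 0 then x = 2 and g = 1, so phi_n = 1: no root r of phi_n equals -u. *)
Lemma riley_trace2 (K : comNzRingType) n : riley (2 : K) 1 n = 1.
Proof.
rewrite /riley; case: n => m; rewrite lrec_hrec; first exact: hrec_cst.
by rewrite (_ : 2 - 1 = 1) ?hrec_cst //; ring.
Qed.

(** * Density of the eigenvalue pairs in the curve *)

Section Density.
Variables (R : realType) (n : int).
Local Notation C := (R[i]).

Lemma Aval_eigenvalue_pair (x : C * C) : @eigenvalue_pairs R n x -> Aval x.1 x.2 n = 0.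
Proof.
case: x => l m /eigenvalue_pair_equation[m0 [r phi0 rE]] /=.
have [N0|N0] := eqVneq (l + m ^+ 2) 0; last first.
  have rE' : r = (m ^+ 2 - 1) * (1 - l) / (l + m ^+ 2) by rewrite rE mulfK.
  by rewrite Aval_riley // -rE' [riley _ _ _]phi0 mulr0.
(* On L + M^2 = 0 the formula for r breaks down; there the relation reads (M^2 - 1)(1 - L) = 0, so
   Y, G and D all vanish. *)
have lE : l = - m ^+ 2 by apply/eqP; rewrite -addr_eq0 N0.
rewrite N0 mulr0 in rE.
have GE : l + m ^+ 6 = 0.
  rewrite (_ : _ + _ = - m ^+ 2 * ((m ^+ 2 - 1) * (1 - l)) * -1 ); last
    by rewrite lE; ring.
  by rewrite rE mulr0 mul0r.
have YE : (m ^+ 2 - 1) ^+ 2 * (1 - l) * (m ^+ 4 - l) = 0.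
  rewrite (_ : _ * _ = (m ^+ 2 - 1) * (1 - l) * ((m ^+ 2 - 1) * (m ^+ 4 - l)));
    last by ring.
  by rewrite rE mul0r.
case: n phi0 => [[|k]|k].
- by move=> /eqP; rewrite oner_eq0.
- case: k => [|k] _; first exact: GE.
  rewrite /Aval N0 GE YE !(expr0n, mul0r, mulr0, subr0, addr0) /=.
  by rewrite -[hrec _ _ _ _ _]/(hrec 0 0 0 0 k.+1) hrec0 mulr0.
rewrite /Aval N0 GE YE => _.
by rewrite !(expr0n, mul0r, mulr0, subr0, addr0) hrec0 mulr0.
Qed.

Lemma exists_meridian (b g : {poly C}) : b != 0 -> g != 0 ->
  exists m, [/\ m != 0, m ^+ 4 != 1, g.[m] != 0 & b.[(m - m^-1) ^+ 2] != 0].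
Proof.
move=> b0 g0; pose s := size b.
(* B is b((m - 1/m)^2) with denominators cleared by m^(2s). *)
pose B : {poly C} := \sum_(i < s) b`_i *: (('X^2 - 1) ^+ (2 * i) * 'X^(2 * (s - i))).
have BE m : m != 0 -> B.[m] = m ^+ (2 * s) * b.[(m - m^-1) ^+ 2].
  move=> m0; rewrite horner_sum horner_coef mulr_sumr; apply: eq_bigr => i _.
  have Xm : ('X^2 - 1 : {poly C}).[m] = m ^+ 2 - 1 by rewrite !hornerE.
  rewrite hornerZ hornerM horner_exp hornerXn Xm [RHS]mulrCA; congr (_ * _).
  have -> : m - m^-1 = (m ^+ 2 - 1) / m by rewrite expr2; field.
  rewrite -exprM exprMn exprVn [RHS]mulrCA; congr (_ * _).
  have -> : (2 * s = 2 * i + 2 * (s - i))%N by rewrite -mulnDr subnKC // ltnW.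
  by rewrite exprD mulrAC divff ?mul1r // expf_neq0.
have B0 : B != 0.
  (* Every u0 is attained, by solving m - 1/m = w with w^2 = u0. *)
  have /closed_nonrootP[u0 bu] := b0.
  have [w wE] : exists w : C, w ^+ 2 = u0 by exists (sqrtC u0); rewrite sqrtCK.
  have [|m /eqP] := @closed_field_root C ('X^2 - w%:P * 'X - 1).
    have [sw _] := top_coefM (top_coefC w) (top_coefX C).
    have s1 : (size (1 : {poly C})%R <= 2)%N by rewrite size_poly1.
    have Pw :=
      top_coefD (top_coefD (top_coefXn 2 (top_coefX C)) (top_coefN (top_coefW sw)))
      (top_coefN (top_coefW s1)).
    have c1 : (1 ^+ 2 - 0 - 0 : C) = 1 by rewrite expr1n !subr0.
    by have [|-> //] := top_coef_lead Pw; rewrite c1 oner_neq0.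
  rewrite !hornerE => mE.
  have m0 : m != 0.
    by apply/eqP => m0; move: mE => /eqP;
      rewrite m0 expr0n /= mulr0 subr0 sub0r oppr_eq0 oner_eq0.
  have mu : (m - m^-1) ^+ 2 = u0.
    rewrite -wE; congr (_ ^+ 2); apply: (mulIf m0); rewrite mulrBl mulVf //.
    by apply/eqP; rewrite -subr_eq0 -mE -expr2; apply/eqP; ring.
  by apply: contraNneq bu => B0; have := BE _ m0;
    rewrite B0 horner0 mu => /esym/eqP;
     rewrite mulf_eq0 expf_eq0 (negPf m0) andbF.
have /closed_nonrootP[m] : 'X * ('X^4 - 1) * g * B != 0.
  by rewrite !mulf_neq0 ?polyX_eq0 // -size_poly_eq0 size_XnsubC.
rewrite !rootM !negb_or !rootE !hornerE => /andP[/andP[/andP[m0 m4] gm] Bm].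
exists m; split=> //; first by rewrite -subr_eq0.
by apply: contraNneq Bm => bm; rewrite BE // bm mulr0.
Qed.

Lemma eigenvalue_pairs_dense (g : {poly C}) : g != 0 ->
  exists m (ls : seq C), [/\ g.[m] != 0, uniq ls, size ls = Adeg n &
    forall l, l \in ls -> @eigenvalue_pairs R n (l, m)].
Proof.
move=> g0; have [b b0 bP] := riley_poly_generic_roots C n.
(* Its value at u is phi_n at r = 0, so avoiding its roots keeps r nonzero. *)
pose b1 : {poly C} := riley 2 (1 + 'X) n.
have b1E u : b1.[u] = riley 2 (1 + u) n.
  rewrite -[LHS]/(horner_eval u b1) rmorph_riley /=.
  by congr (riley _ _ _); rewrite /horner_eval !hornerE.
have b10 : b1 != 0.
  have : b1.[0] != 0 by rewrite b1E addr0 riley_trace2 oner_neq0.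
  by apply: contraNneq => ->; rewrite horner0.
have [m [m0 m4 gm]] := exists_meridian (mulf_neq0 b0 b10) g0.
rewrite hornerM mulf_eq0 negb_or -/(riley_u m) => /andP[bm b1m].
have [rs [urs srs rts]] := bP _ bm.
have /choice[f fP] r : exists l, r \in rs -> @eigenvalue_pairs R n (l, m) /\
    (m ^+ 2 - 1) * (1 - l) = r * (l + m ^+ 2).
  have [rrs|] := boolP (r \in rs); last by exists 0.
  have := allP rts _ rrs; rewrite rootE horner_riley_poly => /eqP phi0.
  have r0 : r != 0.
    by apply/eqP => r0; case/eqP: b1m; rewrite b1E -[RHS]phi0 r0 mul0r !addr0.
  have ru0 : r + riley_u m != 0.
    apply/eqP => ru0; move: phi0;
      rewrite -(addrA 1 r) ru0 mulr0 !addr0 riley_trace2 => /eqP.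
    by rewrite oner_eq0.
  by have [l lP] := mem_eigenvalue_pairs m0 r0 ru0 phi0; exists l.
exists m, (map f rs); split=> //; last 2 first.
- by rewrite size_map.
- by move=> _ /mapP[r /fP[Er _] ->].
(* The relation recovers r from l unless l = -m^2, which would force m^4 = 1. *)
rewrite map_inj_in_uniq // => r r' /fP[_ rE] /fP[_ rE'] ff.
rewrite -ff rE in rE'; have [N0|N0] := eqVneq (f r + m ^+ 2) 0; last
  exact: (mulIf N0).
case/eqP: m4; move: rE; rewrite N0 mulr0 => rE.
have fE : f r = - m ^+ 2 by apply/eqP; rewrite -addr_eq0 N0.
by apply/eqP; rewrite -subr_eq0 -[X in _ == X]rE fE; apply/eqP; ring.
Qed.
End Density.

(** * The explicit formula *)

Section BinomialSums.
Variable R : comNzRingType.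
Implicit Types v x g : R.

(** These two sums are Morgan-Voyce polynomials, solutions of the recurrence with x = 2 + v expanded
    in powers of v. *)
Definition even_sum v m : R := \sum_(j < m.+1) 'C(m + j, 2 * j)%:R * v ^+ j.
Definition odd_sum v m : R := \sum_(j < m) 'C(m + j, 2 * j + 1)%:R * v ^+ j.

Lemma even_sum_widen v m k : (m < k)%N ->
  even_sum v m = \sum_(j < k) 'C(m + j, 2 * j)%:R * v ^+ j.
Proof.
move=> mk;
  rewrite /even_sum (big_ord_widen _ (fun j => 'C(m + j, 2 * j)%:R * v ^+ j) mk).
rewrite big_mkcond; apply: eq_bigr => j _; case: ltnP => // mj.
by rewrite bin_small ?mul0r //; lia.
Qed.

Lemma odd_sum_widen v m k : (m <= k)%N ->
  odd_sum v m = \sum_(j < k) 'C(m + j, 2 * j + 1)%:R * v ^+ j.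
Proof.
move=> mk;
  rewrite /odd_sum (big_ord_widen _ (fun j => 'C(m + j, 2 * j + 1)%:R * v ^+ j) mk).
rewrite big_mkcond; apply: eq_bigr => j _; case: ltnP => // mj.
by rewrite bin_small ?mul0r //; lia.
Qed.

(** Pascal's rule; with [even_sumS] it makes both sums satisfy the recurrence of phi_n for x = 2 +
    v. *)
Lemma odd_sumS v m : odd_sum v m.+1 = odd_sum v m + even_sum v m.
Proof.
rewrite (odd_sum_widen v (leqnSn m)) /odd_sum /even_sum -big_split /=.
apply: eq_bigr => j _; rewrite -mulrDl -natrD.
by rewrite addn1 addSn binS.
Qed.

Lemma even_sumS v m : even_sum v m.+1 = even_sum v m + v * odd_sum v m.+1.
Proof.
rewrite (even_sum_widen v (ltnW (ltnSn m.+1))) /even_sum big_ord_recl [in RHS]big_ord_recl.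
rewrite !muln0 !bin0 -addrA; congr (_ + _).
rewrite /odd_sum mulr_sumr -big_split /=; apply: eq_bigr => j _.
rewrite /bump /= !add1n mulnS add2n [(m.+1 + j.+1)%N]addSn binS natrD addn1 addnS addSn exprS.
by ring.
Qed.

Lemma even_sum0 v : even_sum v 0 = 1.
Proof. by rewrite /even_sum big_ord1 bin0 expr0 mulr1. Qed.

Lemma odd_sum0 v : odd_sum v 0 = 0.
Proof. by rewrite /odd_sum big_ord0. Qed.

Lemma lrec_unique x (f : nat -> R) :
  (forall k, f k.+2 = x * f k.+1 - f k) -> forall k, f k = lrec x (f 0%N) (f 1%N) k.
Proof.
move=> fS k; suff [] : f k = lrec x (f 0%N) (f 1%N) k /\
  f k.+1 = lrec x (f 0%N) (f 1%N) k.+1 by [].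
by elim: k => [//|k [IH1 IH2]]; split=> //; rewrite fS lrecSS IH1 IH2.
Qed.

Lemma riley_sum_pos v y m :
  riley (2 + v) (1 + y) (Posz m.+1) = even_sum v m + y * odd_sum v m.+1.
Proof.
rewrite /riley [RHS](@lrec_unique (2 + v) (fun m => even_sum v m + y * odd_sum v m.+1)).
  rewrite /= !even_sumS !odd_sumS !even_sumS !odd_sumS even_sum0 odd_sum0.
  by congr (lrec _ _ _ _); ring.
by move=> k; rewrite !(even_sumS, odd_sumS); ring.
Qed.

Lemma riley_sum_neg v y m :
  lrec (2 + v) 1 ((2 + v) - (1 + y)) m = even_sum v m - y * odd_sum v m.
Proof.
rewrite [RHS](@lrec_unique (2 + v) (fun m => even_sum v m - y * odd_sum v m)).
  rewrite /= !(even_sumS, odd_sumS) even_sum0 odd_sum0.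
  by congr (lrec _ _ _ _); ring.
by move=> k; rewrite !(even_sumS, odd_sumS); ring.
Qed.

Lemma big_parity (F : nat -> R) m :
  \sum_(0 <= i < 2 * m) F i =
  \sum_(j < m) F (2 * j)%N + \sum_(j < m) F (2 * j).+1.
Proof.
elim: m => [|m IH]; first by rewrite muln0 big_nil !big_ord0 addr0.
by rewrite mulnS add2n !big_nat_recr //= IH !big_ord_recr /=; ring.
Qed.

Lemma formula_sum_pos X a b m (n := Posz m.+1) :
  \sum_(0 <= i < 2 * m.+1)
    'C(absz (n + ((i%:Z - 1) %/ 2)%Z), i)%:R * X ^+ i *
    a ^+ (i %/ 2) * b ^+ (i.+1 %/ 2)
  = even_sum (X * a * (X * b)) m + X * b * odd_sum (X * a * (X * b)) m.+1.
Proof.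
rewrite big_parity /even_sum /odd_sum mulr_sumr; congr (_ + _);
  apply: eq_bigr => j _.
  (* The floor is j - 1, also for j = 0, where -1/2 is rounded down to -1; and n = m + 1. *)
  have -> : absz (n + (((2 * j)%N%:Z - 1) %/ 2)%Z) = (m + j)%N by rewrite /n;
    lia.
  have -> : (2 * j %/ 2 = j)%N by lia.
  have -> : ((2 * j).+1 %/ 2 = j)%N by lia.
  by rewrite !exprMn exprM -!mulrA; congr (_ * _); rewrite exprMn; ring.
have -> : absz (n + (((2 * j).+1%N%:Z - 1) %/ 2)%Z) = (m.+1 + j)%N
  by rewrite /n; lia.
have -> : ((2 * j).+1 %/ 2 = j)%N by lia.
have -> : ((2 * j).+2 %/ 2 = j.+1)%N by lia.
rewrite addn1 !exprMn !exprS exprM exprMn; ring.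
Qed.

Lemma formula_sum_neg X a b m (n : int := - m%:Z) :
  \sum_(0 <= i < (2 * m).+1)
    'C(absz (- n + (i%:Z %/ 2)%Z), i)%:R * X ^+ i *
    a ^+ (i %/ 2) * b ^+ (i.+1 %/ 2)
  = even_sum (X * a * (X * b)) m + X * b * odd_sum (X * a * (X * b)) m.
Proof.
(* The last index i = 2m has no odd partner and is split off. *)
rewrite big_nat_recr //= big_parity /even_sum big_ord_recr /= /odd_sum mulr_sumr.
rewrite addrAC; congr (_ + _ + _); first (apply: eq_bigr => j _); last
  (apply: eq_bigr => j _).
- have -> : absz (- n + ((2 * j)%N%:Z %/ 2)%Z) = (m + j)%N by rewrite /n; lia.
  have -> : (2 * j %/ 2 = j)%N by lia.
  have -> : ((2 * j).+1 %/ 2 = j)%N by lia.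
  by rewrite !exprMn exprM -!mulrA; congr (_ * _); rewrite exprMn; ring.
- have -> : absz (- n + ((2 * m)%N%:Z %/ 2)%Z) = (m + m)%N by rewrite /n; lia.
  have -> : (2 * m %/ 2 = m)%N by lia.
  have -> : ((2 * m).+1 %/ 2 = m)%N by lia.
  by rewrite !exprMn exprM -!mulrA; congr (_ * _); rewrite exprMn; ring.
have -> : absz (- n + ((2 * j).+1%N%:Z %/ 2)%Z) = (m + j)%N by rewrite /n; lia.
have -> : ((2 * j).+1 %/ 2 = j)%N by lia.
have -> : ((2 * j).+2 %/ 2 = j.+1)%N by lia.
rewrite addn1 !exprMn !exprS exprM exprMn; ring.
Qed.
End BinomialSums.

Lemma polyM_neq0 : polyM != 0.
Proof. by rewrite polyC_eq0 polyX_eq0. Qed.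

Lemma polyL_add_sqr_neq0 : polyL + polyM ^+ 2 != 0.
Proof. by rewrite /polyL /polyM -rmorphXn /= -size_poly_eq0 size_XaddC. Qed.

Section Formula.
Variables (K : fieldType) (L M : K).
Hypotheses (M0 : M != 0) (N0 : L + M ^+ 2 != 0).

Let X : K := (M ^+ 2 - 1) / (L + M ^+ 2).
Let a : K := 1 - L.
Let b : K := M ^+ 2 - L * M ^- 2.
Let v : K := X * a * (X * b).

(** With these X, a and b one has r = X a and r + u = X b, hence x = 2 + v and g = 1 + X b. *)
Lemma Aval_riley_sums n : Aval L M n =
  M ^+ (2 * `|n|) * (L + M ^+ 2) ^+ Adeg n * riley (2 + v) (1 + X * b) n.
Proof.
rewrite Aval_riley //; congr (_ * riley _ _ _).
- by rewrite /v /X /a /b; field; rewrite ?M0 ?N0.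
- by rewrite /X /b; field; rewrite ?M0 ?N0.
Qed.

Lemma Aval_formula_pos (m : nat) (n := Posz m.+1) :
  Aval L M n = M ^ (2 * n) * (L + M ^+ 2) ^ (2 * n - 1) *
  \sum_(0 <= i < absz (2 * n))
    'C(absz (n + ((i%:Z - 1) %/ 2)%Z), i)%:R *
    ((M ^+ 2 - 1) / (L + M ^+ 2)) ^+ i *
    (1 - L) ^+ (i %/ 2) *
    (M ^+ 2 - L * M ^- 2) ^+ (i.+1 %/ 2).
Proof.
rewrite Aval_riley_sums riley_sum_pos -/X -/a -/b.
have -> : absz (2 * n) = (2 * m.+1)%N by rewrite /n; lia.
have -> : 2 * n - 1 = Posz (2 * m).+1 by rewrite /n; lia.
have -> : 2 * n = Posz (2 * m.+1) by rewrite /n; lia.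
by rewrite formula_sum_pos.
Qed.

(** The base of the i-th power is -X here: this leaves v unchanged and reverses the sign of the odd
    part, as [riley_sum_neg] requires. *)
Lemma Aval_formula_neg (m : nat) (n : int := - m%:Z) :
  Aval L M n = M ^ (- 2 * n) * (L + M ^+ 2) ^ (- 2 * n) *
  \sum_(0 <= i < (absz (- 2 * n)).+1)
    'C(absz (- n + (i%:Z %/ 2)%Z), i)%:R *
    ((1 - M ^+ 2) / (L + M ^+ 2)) ^+ i *
    (1 - L) ^+ (i %/ 2) *
    (M ^+ 2 - L * M ^- 2) ^+ (i.+1 %/ 2).
Proof.
rewrite Aval_riley_sums -/a -/b.
have XN : (1 - M ^+ 2) / (L + M ^+ 2) = - X by rewrite /X -[RHS]mulNr opprB.
have -> : absz (- 2 * n) = (2 * m)%N by rewrite /n; lia.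
have -> : - 2 * n = Posz (2 * m) by rewrite /n; lia.
rewrite XN formula_sum_neg.
have -> : - X * a * (- X * b) = v by rewrite /v; ring.
rewrite !mulNr -riley_sum_neg; congr (_ * _ * _).
- by rewrite abszN.
- by rewrite /n; case: m {n}.
- by rewrite /n; case: m {n}.
Qed.
End Formula.

Lemma ratM_neq0 : ratM != 0.
Proof. by rewrite tofrac_eq0 polyM_neq0. Qed.

Lemma ratL_add_sqr_neq0 : ratL + ratM ^+ 2 != 0.
Proof.
have -> : ratL + ratM ^+ 2 = tofrac (polyL + polyM ^+ 2)
  by rewrite rmorphD rmorphXn.
by rewrite tofrac_eq0 polyL_add_sqr_neq0.
Qed.

Lemma tofrac_Apoly n : tofrac (Apoly n) = Aval ratL ratM n.
Proof. exact: rmorph_Aval. Qed.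

Lemma A_formula_posE n : 0 < n -> tofrac (Apoly n) = A_formula_pos n.
Proof.
case: n => [[|m]|m] // _; rewrite tofrac_Apoly.
exact: (Aval_formula_pos ratM_neq0 ratL_add_sqr_neq0 m).
Qed.

Lemma A_formula_negE n : n <= 0 -> tofrac (Apoly n) = A_formula_neg n.
Proof.
move=> n0; have [m ->] : exists m : nat, n = - m%:Z by exists `|n|%N; lia.
rewrite tofrac_Apoly.
exact: (Aval_formula_neg ratM_neq0 ratL_add_sqr_neq0 m).
Qed.

Theorem theorem1p1 (R : realType) (n : int) :
  (exists A : {poly {poly int}}, A_polynomial R n A) /\
  (forall A : {poly {poly int}}, A_polynomial R n A ->
    (0 < n -> tofrac A = A_formula_pos n \/ tofrac A = - A_formula_pos n) /\
    (n <= 0 -> tofrac A = A_formula_neg n \/ tofrac A = - A_formula_neg n)).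
Proof.
have [k [sF lF]] := Apoly_lead n.
have dense (g : {poly R[i]}) : g != 0 -> exists m (ls : seq R[i]),
    [/\ g.[m] != 0, uniq ls, size ls = (size (Apoly n)).-1 &
        forall l, l \in ls -> @eigenvalue_pairs R n (l, m)].
  by rewrite sF; apply: eigenvalue_pairs_dense.
have sub : (@eigenvalue_pairs R n `<=` @zero_set R (Apoly n))%classic.
  by move=> x /Aval_eigenvalue_pair; rewrite /zero_set /= eval2_Apoly.
have Aex := A_polynomial_of_dense lF (Apoly_fiber0 n) (Apoly_coef0 n) dense sub.
split; first by exists (Apoly n).
move=> A AP.
have [->|->] := A_polynomial_unique lF (Apoly_fiber0 n) dense sub AP.
  by split=> n0; left; [apply: A_formula_posE|apply: A_formula_negE].
split=> n0; right; rewrite rmorphN; congr (- _).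
  exact: A_formula_posE.
exact: A_formula_negE.
Qed.
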